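(* Assume that, for every $i\in\{1,\dots,m\}$ and $x\in\mathbb T^N$, the map $p\mapsto H_i(x,p)$ is strictly convex on $\mathbb R^N$. Let $y\in\mathcal A$. Then, for each $i\in\{1,\dots,m\}$, there exists a vector $p_i\in\mathbb R^N$ which is a reachable gradient of $u_i$ at $y$ for every $\mathbf u\in\mathcal H(0)$ and which satisfies $$H_i(y,p_i)+\big(B(y)\mathbf u(y)\big)_i=0$$ for every $\mathbf u\in\mathcal H(0)$.
   Context: Let $N,m$ be positive integers, $\mathbb T^N=\mathbb R^N/\mathbb Z^N$ the flat torus. A convex Hamiltonian is a continuous $H:\mathbb T^N\times\mathbb R^N\to\mathbb R$ such that $p\mapsto H(x,p)$ is convex for every $x$ and there are $\alpha,\beta:\mathbb R_+\to\mathbb R$ tending to $+\infty$ at $+\infty$ with $\alpha(|p|)\leqslant H(x,p)\leqslant\beta(|p|)$ for all $(x,p)$. Let $H_1,\dots,H_m$ be convex Hamiltonians. An $m\times m$ real matrix $(b_{ij})$ is a coupling matrix if $b_{ij}\leqslant0$ for $j\ne i$ and $\sum_j b_{ij}\geqslant0$ for every $i$; it is degenerate if moreover $\sum_j b_{ij}=0$ for every $i$; a matrix is irreducible if for every nonempty $\mathcal I\subsetneq\{1,\dots,m\}$ there are $i\in\mathcal I$, $j\notin\mathcal I$ with $b_{ij}\neq0$. Let $B(x)=(b_{ij}(x))$ have continuous coefficients on $\mathbb T^N$ and be an irreducible degenerate coupling matrix for every $x$. Write $(B(x)\mathbf u(x))_i=\sum_j b_{ij}(x)u_j(x)$. For continuous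 $u$, $D^+u(x_0)$ (resp. $D^-u(x_0)$) is the set of $D\phi(x_0)$ with $\phi$ of class $C^1$ near $x_0$ and $u-\phi$ having a local maximum (resp. minimum) at $x_0$. For $a\in\mathbb R$, $\mathbf u\in(C(\mathbb T^N))^m$ is a (viscosity) subsolution [resp. supersolution] of $H_i(x,Du_i)+(B(x)\mathbf u(x))_i=a$ in $\mathbb T^N$, $i=1,\dots,m$, if for all $x$ and $i$: $H_i(x,p)+(B(x)\mathbf u(x))_i\leqslant a$ for all $p\in D^+u_i(x)$ [resp. $\geqslant a$ for all $p\in D^-u_i(x)$]; a solution is both. $\mathcal H(a)$ denotes the set of subsolutions (they are Lipschitz continuous). The critical value is $c=\inf\{a\in\mathbb R:\mathcal H(a)\neq\varnothing\}$; it is assumed, by normalization, that $c=0$. ''Critical'' sub/super/solutions refer to $a=0$. For $x,y\in\mathbb T^N$, $i,j\in\{1,\dots,m\}$ set $\Phi_{i,j}(y,x)=\sup_{\mathbf v\in\mathcal H(0)}\big(v_i(x)-v_j(y)\big)$, and let $\Phi_{\cdot,j}(y,\cdot)=(\Phi_{1,j}(y,\cdot),\dots,\Phi_{m,j}(y,\cdot))^T$. The Aubry set is $\mathcal A=\{y\in\mathbb T^N:\Phi_{\cdot,i}(y,\cdot)\text{ is a critical solution}\}$, where $i$ is any fixed index (the set does not depend on $i$). For a locally Lipschitz $u$ on $\mathbb T^N$, a reachable gradient of $u$ at $x_0$ is a vector of the form $\lim_n Du(x_n)$, where $u$ is differentiable at each $x_n$ and $x_n\to x_0$. *)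

(* Defs.v *)
From HB Require Import structures.
From mathcomp Require Import all_boot all_order all_algebra.
From mathcomp Require Import all_classical all_reals all_analysis.

Set Implicit Arguments.
Unset Strict Implicit.
Unset Printing Implicit Defensive.

Import Order.TTheory GRing.Theory Num.Theory.
Import numFieldNormedType.Exports.

Local Open Scope classical_set_scope.
Local Open Scope ring_scope.

(* Conventions. A function on the flat torus R^N / Z^N is represented by its
   lift, a Z^N-periodic function on 'rV[R]_N; a point of the torus is represented
   by any of its lifts. Continuity, (sub/super)differentials and reachable
   gradients are local, hence unaffected by passing to the lift. *)

Section Euclidean.
Context {R : realType} {N : nat}.
Implicit Types (x p : 'rV[R]_N) (u phi : 'rV[R]_N -> R).

(* The library norm on 'rV[R]_N is the sup norm. *)
Definition enorm p : R := Num.sqrt (\sum_(k < N) p 0 k ^+ 2).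

(* Meaningful only at points where u is differentiable. *)
Definition grad u x : 'rV[R]_N :=
  \row_(k < N) ('d u x : 'rV[R]_N -> R) (delta_mx 0 k).

Definition C1_near phi x0 : Prop :=
  \forall x \near x0, differentiable phi x /\ {for x, continuous (grad phi)}.

Definition superdiff u x0 : set 'rV[R]_N :=
  [set p | exists phi, [/\ C1_near phi x0,
     \forall x \near x0, u x - phi x <= u x0 - phi x0 & p = grad phi x0]].

Definition subdiff u x0 : set 'rV[R]_N :=
  [set p | exists phi, [/\ C1_near phi x0,
     \forall x \near x0, u x0 - phi x0 <= u x - phi x & p = grad phi x0]].

Definition reachable_gradient u x0 : set 'rV[R]_N :=
  [set p | exists x_ : nat -> 'rV[R]_N,
     [/\ forall n, differentiable u (x_ n),
         x_ n @[n --> \oo] --> x0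
       & grad u (x_ n) @[n --> \oo] --> p]].

Definition Zperiodic u : Prop :=
  forall k : 'rV[int]_N, periodic u (map_mx intr k).

Definition torus_continuous u : Prop := continuous u /\ Zperiodic u.

Definition strictly_convex u : Prop :=
  forall p q (t : R), p != q -> 0 < t < 1 ->
    u (t *: p + (1 - t) *: q) < t * u p + (1 - t) * u q.

(* Only the values of alpha and beta on [0, +oo[ matter. *)
Definition convex_hamiltonian (H : 'rV[R]_N -> 'rV[R]_N -> R) : Prop :=
  [/\ continuous (fun z : 'rV[R]_N * 'rV[R]_N => H z.1 z.2),
      forall p, Zperiodic (H ^~ p),
      forall x, convex_function [set: 'rV[R]_N] (H x)
    & exists alpha beta : R -> R,
        [/\ alpha r @[r --> +oo] --> +oo,
            beta r @[r --> +oo] --> +oo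
          & forall x p, alpha (enorm p) <= H x p <= beta (enorm p)]].

End Euclidean.

Section CouplingMatrix.
Context {R : realType} {m : nat}.
Implicit Type b : 'M[R]_m.

Definition coupling_mx b : Prop :=
  (forall i j, j != i -> b i j <= 0) /\ (forall i, 0 <= \sum_j b i j).

Definition degenerate_mx b : Prop :=
  coupling_mx b /\ forall i, \sum_j b i j = 0.

Definition irreducible_mx b : Prop :=
  forall I : {set 'I_m}, I != finset.set0 -> I \proper finset.setT ->
    exists i j, [/\ i \in I, j \notin I & b i j != 0].

End CouplingMatrix.

Section System.
Context {R : realType} {N m : nat}.
Variables (H : 'I_m -> 'rV[R]_N -> 'rV[R]_N -> R) (B : 'rV[R]_N -> 'M[R]_m).
Implicit Types (u v : 'I_m -> 'rV[R]_N -> R) (a : R).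

Definition coupling u (x : 'rV[R]_N) (i : 'I_m) : R :=
  \sum_j B x i j * u j x.

Definition subsolution a u : Prop :=
  (forall i, torus_continuous (u i)) /\
  forall x i p, superdiff (u i) x p -> H i x p + coupling u x i <= a.

Definition supersolution a u : Prop :=
  (forall i, torus_continuous (u i)) /\
  forall x i p, subdiff (u i) x p -> a <= H i x p + coupling u x i.

Definition solution a u : Prop := subsolution a u /\ supersolution a u.

(* An extended real, so that requiring it to be 0 excludes the junk value of
   the real infimum. *)
Definition critical_value : \bar R :=
  ereal_inf [set a%:E | a in [set a | subsolution a !=set0]].

Definition Phi (i j : 'I_m) (y x : 'rV[R]_N) : R :=
  sup [set v i x - v j y | v in subsolution 0].

Definition Aubry (j : 'I_m) : set 'rV[R]_N :=
  [set y | solution 0 (fun i x => Phi i j y x)].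

End System.

(* Main.v *)
Require Import Defs.
From HB Require Import structures.
From mathcomp Require Import finmap.
From mathcomp Require Import all_boot all_order all_algebra.
From mathcomp Require Import all_classical all_reals all_analysis.
From mathcomp Require Import measurable_realfun ring lra.

(** Write Phi_j for Phi j j0 y. As y lies in the Aubry set, the family Phi is a
    solution, and by definition u_j - Phi_j <= u_j0(y) for every subsolution u,
    with equality for j = j0 at y. So y maximizes u_j0 - Phi_j0, and doubling of
    variables at y (doubling, touching_gradients) lets the subsolution inequality
    for u_j0 be compared with the supersolution inequality for Phi_j0: the
    component j0 of B(y)(Phi - u)(y) is nonnegative. But Phi - u is minimal at j0,
    so the signs of B(y) make it take the same value at all k with b_(j0,k)(y)
    nonzero, and irreducibility spreads this to all indices (touches_all): y
    maximizes every u_j - Phi_j, and B(y)u(y) = B(y)Phi(y) does not depend on u.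

    Doubling with the mean of finitely many subsolutions u yields, for a fixed i,
    limits P_u at y of superdifferentials of u_i such that H_i(y, P_u) is at most
    - (B(y)Phi(y))_i, while H_i at y and at the mean of the P_u is at least this number.
    Strict convexity makes all the P_u equal (common_gradient). For each u the
    admissible vectors form a compact set, so the finite intersection property
    gives one vector p for all subsolutions.

    It remains to see that p is a limit of gradients and not only of
    superdifferentials (limit_superdiff_reachable). It lies on the boundary of a
    strictly convex sublevel set of H_i(y, .), hence is exposed by some direction q
    (exposed_normal). Superdifferentials close to p show that u_i grows along q, on
    small segments near y, at a rate close to <q, p>. Rademacher's theorem, in the
    form that finds differentiability points where the derivative along q is at
    least this rate (exists_frechet_ge), then provides gradients which can only
    accumulate at p.

    Rademacher's theorem is derived from Lebesgue's theorem on the line. Null sets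
    are handled through iterated one-dimensional slices (shadow), whose order can
    be exchanged by Tonelli's theorem, and a point where u and the distance
    functions to countably many sets have all their partial derivatives is shown to
    be a point of differentiability of u (partials_frechet). *)

Set Implicit Arguments.
Unset Strict Implicit.
Unset Printing Implicit Defensive.

Import Order.TTheory GRing.Theory Num.Theory.
Import numFieldNormedType.Exports.

Local Open Scope classical_set_scope.
Local Open Scope ring_scope.

(** * Lipschitz functions of one variable *)

Lemma inv_natS_lt (R : realType) (e : R) : 0 < e -> exists n : nat, n.+1%:R^-1 < e.
Proof.
move=> e0; have := near_infty_natSinv_lt (PosNum e0) => -[n _ /(_ n (leqnn n))] /= ?.
by exists n.
Qed.

Lemma cvg_inv_natS (R : realType) (G : set_system nat) : \oo `<=` G ->
  (n.+1%:R^-1 : R) @[n --> G] --> (0 : R).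
Proof. by move=> Goo; apply: cvg_trans (@cvg_harmonic R); apply: cvg_app; exact: Goo. Qed.

(** Stated with non-strict inequalities on closed intervals of increments, so
    that fixing e, d and l carves out a closed set of base points. *)
Definition has_der {R : realType} (g : R -> R) (s l : R) : Prop :=
  forall e, 0 < e -> exists2 d, 0 < d &
    forall t, `|t| <= d -> `|g (s + t) - g s - t * l| <= e * `|t|.

Section OneDim.
Context {R : realType}.
Implicit Types (g h : R -> R).
Local Notation mu := (@lebesgue_measure R).

Lemma has_der_derive g s l :
  derivable g s 1 -> derive1 g s = l -> has_der g s l.
Proof.
move=> dg gl e e0.
have : h^-1 *: ((g \o shift s) (h *: 1) - g s) @[h --> 0^'] --> l.
  by rewrite -gl derive1E; exact: dg.
move=> /cvgr_dist_le /(_ e e0).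
rewrite near_withinE => /nbhs_ballP[d /= d0 dP].
exists (d / 2); first by rewrite divr_gt0.
move=> t td.
have [->|t0] := eqVneq t 0; first by rewrite addr0 subrr mul0r subrr normr0 mulr0.
have /dP/(_ t0) : ball 0 d t.
  by rewrite /ball /= sub0r normrN (le_lt_trans td)// ltr_pdivrMr// ltr_pMr// ltr1n.
rewrite /= => h1.
rewrite (_ : _ - _ = - (t * (l - t^-1 *: (g (t *: 1 + s) - g s)))); last first.
  by rewrite /GRing.scale /= mulr1 mulrBr mulVKf// opprB (addrC t).
by rewrite normrN normrM mulrC ler_wpM2r.
Qed.

Lemma has_derD g h s l k : has_der g s l -> has_der h s k ->
  has_der (fun x => g x + h x) s (l + k).
Proof.
move=> gl hk e e0; have e20 : 0 < e / 2 by rewrite divr_gt0.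
have [d d0 dP] := gl _ e20; have [d' d'0 dP'] := hk _ e20.
exists (Num.min d d'); first by rewrite lt_min d0.
move=> t; rewrite le_min => /andP[/dP h1 /dP' h2].
rewrite [X in `|X|](_ : _ = (g (s + t) - g s - t * l) + (h (s + t) - h s - t * k)); last by rewrite /=; ring.
rewrite (le_trans (ler_normD _ _))// (le_trans (lerD h1 h2))//.
by rewrite -mulrDl -splitr.
Qed.

Lemma has_der_affine s k c b : has_der (fun x : R => k * (x - c) + b) s k.
Proof.
move=> e e0; exists 1 => // t _.
rewrite [X in `|X|](_ : _ = 0); first by rewrite normr0 mulr_ge0 // ltW.
by rewrite /=; ring.
Qed.

Lemma has_der_eq g h s l (d : R) : 0 < d -> (forall t, `|t| <= d -> g (s + t) = h (s + t)) ->
  has_der g s l -> has_der h s l.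
Proof.
move=> d0 gh gl e e0; have [d' d'0 dP] := gl e e0.
exists (Num.min d d'); first by rewrite lt_min d0.
move=> t; rewrite le_min => /andP[td /dP].
by rewrite gh//; have := gh 0; rewrite addr0 normr0 => ->//; exact: ltW.
Qed.

(** Adding L * x makes g nondecreasing, hence a Stieltjes distribution function.
    Its measure and that of L * x - g add up to 2 * L times the Lebesgue measure,
    so it is absolutely continuous; h is its Radon-Nikodym density, and the almost
    everywhere fundamental theorem of calculus identifies the derivative. *)
Lemma lipschitz_ftc g (L a b : R) : 0 < L -> (forall s t, `|g s - g t| <= L * `|s - t|) -> a < b ->
  exists h, [/\ forall x, 0 <= h x, mu.-integrable setT (EFin \o h),
    forall x, a < x <= b -> (g x - g a + L * (x - a))%:E = (\int[mu]_(t in `]a, x]) (h t)%:E)%E &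
    mu.-negligible [set s | a < s < b /\ ~ has_der g s (h s - L)]].
Proof.
move=> L0 gL ab.
have gLr s t : s <= t -> `|g t - g s| <= L * (t - s).
  by move=> st; rewrite (le_trans (gL _ _))// ger0_norm// subr_ge0.
pose G1 := fun x : R => g x + L * x.
pose G2 := fun x : R => L * x - g x.
have G1n : {homo G1 : x y / x <= y}.
  by move=> x y xy; have := gLr _ _ xy; rewrite ler_norml /G1 => /andP[]; lra.
have G2n : {homo G2 : x y / x <= y}.
  by move=> x y xy; have := gLr _ _ xy; rewrite ler_norml /G2 => /andP[]; lra.
have gc : continuous g.
  move=> x; apply/cvgrPdist_le => e e0; near=> y.
  rewrite (le_trans (gL _ _))// mulrC -ler_pdivlMr//.
  by near: y; apply: (@cvgr_dist_le _ _ _ _ _ id x cvg_id); rewrite divr_gt0.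
have Lc : continuous (fun x : R => L * x) by move=> x; exact: mulrl_continuous.
have G1c : right_continuous G1.
  by apply: right_continuousW => x; apply: continuousD; [exact: gc|exact: Lc].
have G2c : right_continuous G2.
  by apply: right_continuousW => x; apply: continuousB; [exact: Lc|exact: gc].
pose F1 : cumulative R R := HB.pack G1 (isCumulative.Build R _ R G1 G1n G1c).
pose F2 : cumulative R R := HB.pack G2 (isCumulative.Build R _ R G2 G2n G2c).
pose nu1 := lebesgue_stieltjes_measure F1.
pose nu2 := lebesgue_stieltjes_measure F2.
have k0 : 0 <= (2 * L)^-1 by rewrite invr_ge0 mulr_ge0// ltW.
have Eoc (F : cumulative R R) (x y : R) : x <= y -> lebesgue_stieltjes_measure F `]x, y]%classic = (F y - F x)%:E.
  move=> xy; rewrite /lebesgue_stieltjes_measure /measure_extension/= measurable_mu_extE//.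
    exact: wlength_itv_bnd.
  exact: is_ocitv.
have Eoc0 (F : cumulative R R) (x y : R) : y < x -> lebesgue_stieltjes_measure F `]x, y]%classic = 0.
  by move=> yx; rewrite set_itv_ge ?measure0// bnd_simp -leNgt ltW.
have madd A : measure_add nu1 nu2 A = (nu1 A + nu2 A)%E by exact: measure_addE.
(* Both measures give the same length to half-open intervals. *)
have key A : measurable A -> mu A = mscale (NngNum k0) (measure_add nu1 nu2) A.
  move: A; apply: lebesgue_measure_unique => _ [[x y] _ <-] /=.
  rewrite /mscale [X in (_ * X)%E](madd `]x, y]%classic).
  have [xy|yx] := leP x y.
    rewrite /nu1 /nu2 !Eoc// /lebesgue_measure Eoc//= -EFinD -EFinM /G1 /G2; congr EFin.
    have L0q : L != 0 by rewrite gt_eqF.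
    by field.
  by rewrite /nu1 /nu2 !Eoc0// /lebesgue_measure Eoc0//= adde0 mule0.
have mab : measurable (`]a, b]%classic : set (measurableTypeR R)) by exact: measurable_itv.
have nuab : (nu1 `]a, b]%classic < +oo)%E by rewrite /nu1 Eoc ?ltry// ltW.
pose nu : {finite_measure set _ -> \bar R} := mfrestr mab nuab.
have numu : nu `<< mu.
  apply/null_content_dominatesP => A mA A0'.
  have := etrans (esym (key A mA)) A0'; rewrite /mscale [X in (_ * X)%E](madd A).
  move=> /eqP; rewrite mule_eq0 eqe invr_eq0 gt_eqF/= ?mulr_gt0// padde_eq0// => /andP[/eqP A0 _].
  apply/eqP; rewrite eq_le measure_ge0 andbT.
  rewrite -A0 /nu /= /mfrestr /mrestr le_measure// ?inE//; first exact: measurableI.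
have [h [h0 hfin hint hE]] := radon_nikodym_sigma_finite numu.
pose h' := fine \o h.
have hh' : EFin \o h' = h by apply/funext => x; rewrite /= fineK.
have hE' x : a < x <= b -> (\int[mu]_(t in `]a, x]) (h' t)%:E)%E = (g x - g a + L * (x - a))%:E.
  move=> /andP[ax xb].
  transitivity (\int[mu]_(t in `]a, x]) h t)%E.
    by apply: eq_integral => t _; rewrite -hh'.
  rewrite -hE; last exact: measurable_itv.
  rewrite /nu /= /mfrestr /mrestr setIidl; last first.
    by move=> t /=; rewrite !in_itv/= => /andP[-> tx]; rewrite (le_trans tx).
  by rewrite /nu1 Eoc ?(ltW ax)//= /G1; congr EFin; ring.
have hint' : mu.-integrable setT (EFin \o h') by rewrite hh'.
exists h'; split => //.
  by move=> x; rewrite fine_ge0.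
  by move=> x ax; rewrite hE'.
have intS A : measurable A -> mu.-integrable A (EFin \o h').
  by move=> mA; apply: integrableS hint'.
have := @FTC1 _ h' (BRight a) _ _ => /(_ _ _)[].
- by move=> y; apply: intS; exact: measurable_itv.
- exact: open_integrable_locally openT hint'.
move=> N [mN N0 sN]; exists N; split => // s [/andP[as_ sb] ns]; apply: sN => /= ds; apply: ns.
move: ds => /(_ _)[]; first by rewrite lte_fin.
move=> dF FE.
have := has_derD (has_der_derive dF FE) (@has_der_affine s (- L) a (g a)).
apply: (has_der_eq (d := Num.min (s - a) (b - s) / 2)).
  by rewrite divr_gt0// lt_min !subr_gt0 as_.
move=> t; rewrite ler_pdivlMr// le_min => /andP[t1 t2].
have ast : a < s + t <= b.
  have := ler_norm t; have := ler_norm (- t); rewrite normrN; have := normr_ge0 t.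
  by move=> *; apply/andP; split; lra.
have /(congr1 fine) /= := hE' _ ast.
rewrite /Rintegral => ->.
by ring.
Unshelve. all: by end_near.
Qed.

Lemma lipschitz_ae_der g (L : R) : (forall s t, `|g s - g t| <= L * `|s - t|) ->
  mu.-negligible [set s | ~ exists l, has_der g s l].
Proof.
move=> gL.
have L0 : 0 < `|L| + 1 by rewrite ltr_wpDl.
have gL' s t : `|g s - g t| <= (`|L| + 1) * `|s - t|.
  by rewrite (le_trans (gL s t))// ler_wpM2r// (le_trans (ler_norm _))// lerDl.
have : mu.-negligible (\bigcup_(n : nat) [set s : R | - n.+1%:R < s < n.+1%:R /\ ~ exists l, has_der g s l]).
  apply: negligible_bigcup => n.
  have [|h [_ _ _]] := lipschitz_ftc (a := - n.+1%:R) (b := n.+1%:R) L0 gL'.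
    by rewrite (@lt_trans _ _ 0)// ?oppr_lt0 ltr0Sn.
  apply: negligibleS => s /= [sn ns]; split=> // hs; apply: ns; by eexists; exact: hs.
apply: negligibleS => s /= ns.
exists (Num.truncn `|s|) => //=; split => //.
by rewrite -ltr_norml truncnS_gt.
Qed.

(** Otherwise the derivative is below c almost everywhere, and integrating the
    density bounds the increment of g by c * (b - a). *)
Lemma lipschitz_der_ge g (L a b c : R) : (forall s t, `|g s - g t| <= L * `|s - t|) ->
  a < b -> c * (b - a) < g b - g a ->
  ~ mu.-negligible [set s | a < s < b /\ exists2 l, has_der g s l & c <= l].
Proof.
move=> gL ab gab neg.
have L0 : 0 < `|L| + 1 by rewrite ltr_wpDl.
have gL' s t : `|g s - g t| <= (`|L| + 1) * `|s - t|.
  by rewrite (le_trans (gL s t))// ler_wpM2r// (le_trans (ler_norm _))// lerDl.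
have [h [h0 hint hE neg2]] := lipschitz_ftc L0 gL' ab.
set K := `|L| + 1 in hE neg2.
have mab : measurable (`]a, b]%classic : set (measurableTypeR R)) by exact: measurable_itv.
(* With c' + K >= 0 both integrands below are nonnegative; nothing is lost,
   because the derivatives h s - K are at least - K. *)
pose c' := Num.max c (- K).
have gab' : c' * (b - a) < g b - g a.
  rewrite /c' maxEge; case: ifP => // _.
  have := gL b a; rewrite ler_norml => /andP[+ _]; apply: lt_le_trans.
  rewrite gtr0_norm ?subr_gt0// mulNr ltrN2 ltr_pM2r ?subr_gt0//.
  by rewrite /K (le_lt_trans (ler_norm _))// ltrDl.
have cK0 : 0 <= c' + K by rewrite -lerBlDr sub0r /c' le_max lexx orbT.
have : (\int[mu]_(t in `]a, b]) (h t)%:E <= \int[mu]_(t in `]a, b]) (c' + K)%:E)%E.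
  apply: ae_ge0_le_integral => //.
  - by move=> x _; rewrite lee_fin.
  - by apply: (measurable_int mu); apply: integrableS hint.
  - have neg3 : mu.-negligible [set b] by exists [set b]; split => //; rewrite lebesgue_measure_set1.
    have : mu.-negligible ([set s | a < s < b /\ exists2 l, has_der g s l & c <= l] `|`
       [set s | a < s < b /\ ~ has_der g s (h s - K)] `|` [set b]).
      by apply: negligibleU neg3; exact: negligibleU.
    apply: negligibleS => s /=; apply: contra_notP => /not_orP[/not_orP[n1 n2] nb].
    rewrite in_itv/= => /andP[as_ sb]; rewrite lee_fin leNgt; apply/negP => hs.
    have asb : a < s < b by rewrite as_/= lt_neqAle sb andbT; apply/eqP.
    have [hd|nhd] := pselect (has_der g s (h s - K)); last by apply: n2.
    apply: n1; split => //; exists (h s - K) => //.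
    by rewrite lerBrDr ltW// (le_lt_trans _ hs)// lerD2r le_max lexx.
rewrite -hE ?ab ?lexx// integral_cst// [X in (_ * X)%E](_ : _ = (b - a)%:E); last first.
  by apply: (etrans (lebesgue_measure_itv `]a, b])); rewrite /= lte_fin ab -EFinD.
rewrite -EFinM lee_fin => H.
by have : c' * (b - a) < c' * (b - a); [apply: (lt_le_trans gab'); rewrite -(lerD2r (K * (b - a))) -mulrDl|rewrite ltxx].
Qed.
End OneDim.

(** * Sets whose one-dimensional slices are null *)

Section NullSets.
Context {R : realType} {N : nat}.
Local Notation V := 'rV[R]_N.
Local Notation mu := (@lebesgue_measure R).
Implicit Types (x v w : V) (E F : set V).

Definition coord_sets : set (set V) :=
  [set A | exists (k : 'I_N) (B : set R), measurable B /\ A = [set x : V | B (x 0 k)]].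

(** Generated by the coordinates rather than by the open sets: maps into it are
    then measurable as soon as their coordinates are, and open_measurableV shows
    that nothing is lost. *)
Definition borelV := g_sigma_algebraType coord_sets.

Lemma measurable_coord k : measurable_fun setT (fun x : borelV => x 0 k).
Proof.
move=> _ B mB; rewrite setTI; apply: sub_sigma_algebra.
by exists k, B.
Qed.

Lemma measurable_fun_coord d (S : measurableType d) (f : S -> borelV) :
  (forall k, measurable_fun setT (fun s => f s 0 k)) -> measurable_fun setT f.
Proof.
move=> fk; apply: (@measurability d _ S borelV setT f coord_sets) => //.
move=> _ [_ [k [B [mB ->]]] <-].
by have := fk k measurableT B mB.
Qed.

Lemma rowE_delta (x : V) : x = \sum_(k < N) x 0 k *: delta_mx 0 k.
Proof. exact: row_sum_delta. Qed.

Lemma le_coord_norm (x : V) k : `|x 0 k| <= `|x|.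
Proof.
have /mapP[j Hj ->] : `|x ord0 k| \in [seq `|x i.1 i.2| | i : 'I_1 * 'I_N].
  by apply/mapP; exists (ord0, k) => //=; rewrite mem_enum.
by rewrite [leRHS]/Num.norm /= mx_normrE; apply/bigmax_geP; right => /=; exists j.
Qed.

Lemma norm_le_coord (x : V) (r : R) : 0 <= r -> (forall k, `|x 0 k| <= r) -> `|x| <= r.
Proof.
move=> r0 xr; rewrite [leLHS]/Num.norm /= mx_normrE; apply/bigmax_leP => /=; split => //.
by move=> [i j] _ /=; rewrite (ord1 i).
Qed.

(** An open set is the countable union of the boxes with rational centre and
    radius 1 / (n + 1) that it contains. *)
Lemma open_measurableV E : open E -> measurable (E : set borelV).
Proof.
move=> oE.
pose box (z : 'rV[rat]_N * nat) : set borelV :=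
  \bigcap_(k in [set: 'I_N]) [set x | `|x 0 k - ratr (z.1 0 k)| <= z.2.+1%:R^-1].
pose F z := if pselect (box z `<=` E) then box z else set0.
have -> : E = \bigcup_z F z.
  apply/seteqP; split => [x Ex|x [z _]]; last by rewrite /F; case: pselect => // h; exact: h.
  move: oE; rewrite openE => /(_ x Ex) /nbhs_ballP[r /= r0 rE].
  have [n nr] := inv_natS_lt (divr_gt0 r0 (ltr0n R 2)).
  have ex k : exists q : rat, `|x 0 k - ratr q| <= n.+1%:R^-1 :> R.
    have [q] := @rat_in_itvoo R (x 0 k - n.+1%:R^-1) (x 0 k + n.+1%:R^-1) ltac:(by rewrite ltrD2l gtrN// invr_gt0).
    rewrite in_itv/= => /andP[q1 q2]; exists q; rewrite ler_distlC.
    by rewrite !ltW.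
  pose z := (\row_k projT1 (cid (ex k)), n) : 'rV[rat]_N * nat.
  have bz : box z x by move=> k _ /=; rewrite mxE; case: cid.
  exists z => //; rewrite /F; case: pselect => // -[]; move=> y yz; apply: rE.
  rewrite -ball_normE /=; apply: (@le_lt_trans _ _ (n.+1%:R^-1 + n.+1%:R^-1)); last by rewrite (splitr r) ltrD.
  apply: norm_le_coord; first by rewrite addr_ge0// invr_ge0.
  move=> k; rewrite !mxE.
  have h1 : `|x 0 k - ratr (z.1 0 k)| <= n.+1%:R^-1 := bz k I.
  have h2 : `|y 0 k - ratr (z.1 0 k)| <= n.+1%:R^-1 := yz k I.
  by rewrite (le_trans (ler_distD (ratr (z.1 0 k)) _ _))// lerD// distrC.
apply: countable_bigcupT_measurable; first exact: countableP.
move=> z; rewrite /F; case: pselect => [h|h]; last exact: measurable0.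
apply: fin_bigcap_measurable; first exact: finite_finset.
move=> k _.
have := measurable_coord k => /(_ measurableT _ (measurable_itv `[ratr (z.1 0 k) - z.2.+1%:R^-1, ratr (z.1 0 k) + z.2.+1%:R^-1])).
rewrite setTI; set A := (X in measurable X); set A' := (X in _ -> measurable X); suff -> : A = A' by [].
by rewrite /A /A'; apply/seteqP; split => x /=; rewrite in_itv/= ler_distl.

Qed.

Lemma closed_measurableV E : closed E -> measurable (E : set borelV).
Proof.
move=> cE; rewrite -(setCK E); apply: measurableC; apply: open_measurableV.
exact: closed_openC.
Qed.

(** Iterated shadows replace N-dimensional Lebesgue measure: a set with empty
    iterated shadow is null for every iterated one-dimensional integral. Being
    stated with negligibility, the notion applies to arbitrary sets. *)
Definition shadow v E : set V := [set x | ~ mu.-negligible [set t : R | E (x + t *: v)]].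

Lemma measurable_line v : measurable_fun setT (fun z : borelV * measurableTypeR R => (z.1 + z.2 *: v : borelV)).
Proof.
apply: measurable_fun_coord => k.
rewrite (_ : (fun _ => _) = (fun z : borelV * measurableTypeR R => z.1 0 k + z.2 * v 0 k)); last first.
  by apply/funext => z; rewrite !mxE.
apply: measurable_funD.
  by apply: measurableT_comp (measurable_coord k) _; exact: measurable_fst.
by apply: measurable_funM => //; exact: measurable_snd.
Qed.

Lemma measurable_preim_line v E : measurable (E : set borelV) ->
  measurable ((fun z : borelV * measurableTypeR R => (z.1 + z.2 *: v : borelV)) @^-1` E).
Proof. by move=> mE; rewrite -[_ @^-1` _]setTI; exact: (measurable_line v). Qed.

Lemma xsection_line v E (x : borelV) :
  xsection ((fun z : borelV * measurableTypeR R => (z.1 + z.2 *: v : borelV)) @^-1` E) x =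
  [set t | E (x + t *: v)].
Proof. by apply/seteqP; split => t; rewrite /xsection /= inE. Qed.

Lemma measurable_slice v E (x : V) : measurable (E : set borelV) ->
  measurable [set t : measurableTypeR R | E (x + t *: v)].
Proof.
by move=> mE; have := measurable_xsection (x : borelV) (measurable_preim_line v mE); rewrite xsection_line.
Qed.

Lemma measurable_shadow v E : measurable (E : set borelV) -> measurable (shadow v E : set borelV).
Proof.
move=> mE; have mf := measurable_fun_xsection mu (measurable_preim_line v mE).
pose f (x : borelV) := mu [set t | E (x + t *: v)].
have fE : mu \o xsection ((fun z : borelV * measurableTypeR R => (z.1 + z.2 *: v : borelV)) @^-1` E) = f.
  by apply/funext => x /=; rewrite /f xsection_line.
rewrite fE in mf.
have -> : shadow v E = ~` (f @^-1` [set 0%E]).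
  by apply/seteqP; split => x /= h h0; apply: h; apply/negligibleP => //; exact: measurable_slice.
by apply: measurableC; rewrite -[X in measurable X]setTI; apply: mf.
Qed.

(** Tonelli: in the plane through x spanned by v and w, the measure of E is the
    integral of its slices in either order, and vanishes when almost every slice
    along v is null. *)
Lemma shadow_comm v w E : measurable (E : set borelV) ->
  shadow v (shadow w E) `<=` shadow w (shadow v E).
Proof.
move=> mE x /= h neg; apply: h.
have mE1 := measurable_shadow w mE; have mE2 := measurable_shadow v mE.
pose g (z : measurableTypeR R * measurableTypeR R) : borelV := x + z.1 *: v + z.2 *: w.
have mg : measurable_fun setT g.
  apply: measurable_fun_coord => k.
  rewrite (_ : (fun _ => _) = (fun z : measurableTypeR R * measurableTypeR R =>
     (x 0 k + z.1 * v 0 k) + z.2 * w 0 k)); last by apply/funext => z; rewrite !mxE.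
  apply: measurable_funD; last by apply: measurable_funM => //; exact: measurable_snd.
  by apply: measurable_funD => //; apply: measurable_funM => //; exact: measurable_fst.
have mF : measurable (g @^-1` E) by rewrite -[_ @^-1` _]setTI; exact: mg.
have := indic_fubini_tonelli mu mu mF.
rewrite indic_fubini_tonelli_FE// indic_fubini_tonelli_GE//.
have xE t : xsection (g @^-1` E) t = [set s | E (x + t *: v + s *: w)].
  by apply/seteqP; split => s; rewrite /xsection /= inE.
have yE s : ysection (g @^-1` E) s = [set t | E (x + s *: w + t *: v)].
  by apply/seteqP; split => t; rewrite /ysection /= inE /= /g /= addrAC.
have -> : (\int[mu]_y (mu \o ysection (g @^-1` E)) y = 0)%E.
  rewrite (@ge0_ae_eq_integral _ _ _ mu _ _ (cst 0%E)) ?integral0//.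
  - exact: measurable_fun_ysection.
  - apply: negligibleS neg => s /= h1 h2; apply: h1 => _.
    by rewrite yE; apply/negligibleP; [exact: measurable_slice|exact: contrapT].
move=> I0.
have : ae_eq mu setT (mu \o xsection (g @^-1` E)) (cst 0%E).
  apply/ae_eq_integral_abs => //; first exact: measurable_fun_xsection.
  by rewrite -[RHS]I0; apply: eq_integral => t _; rewrite gee0_abs.
apply: negligibleS => t /= h1 h2; apply: h1; apply/negligibleP; first exact: measurable_slice.
by rewrite -[RHS](h2 I) xE.
Qed.

Lemma shadowS v E F : E `<=` F -> shadow v E `<=` shadow v F.
Proof. by move=> EF x /= h neg; apply: h; apply: negligibleS neg => t; exact: EF. Qed.

Lemma shadow0 v : shadow v set0 = set0.
Proof. by apply/seteqP; split => // x /= h; apply: h; exact: negligible_set0. Qed.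

Lemma shadow_bigcup v (E : nat -> set V) : shadow v (\bigcup_n E n) `<=` \bigcup_n shadow v (E n).
Proof.
move=> x /= h; apply: contrapT => h1; apply: h.
have : mu.-negligible (\bigcup_n [set t : measurableTypeR R | E n (x + t *: v)]).
  by apply: negligible_bigcup => n; apply: contrapT => h2; apply: h1; exists n.
by apply: negligibleS => t [n _ ?]; exists n.
Qed.

(** A line through a point of an open set meets it in a set containing an
    interval. *)
Lemma open_shadow v E : open E -> E `<=` shadow v E.
Proof.
move=> oE x Ex /= neg.
have oT : open [set t : R | E (x + t *: v)].
  apply: open_comp oE => t _.
  by apply: cvgD; [exact: cvg_cst|apply: cvgZ; [exact: cvg_id|exact: cvg_cst]].
have : (fun t : R => E (x + t *: v)) 0 by rewrite scale0r addr0.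
move: oT; rewrite openE => /[apply] /nbhs_ballP[r /= r0 rE].
have : mu.-negligible (ball (0 : R) r) by exact: negligibleS neg.
move=> /negligibleP => /(_ (measurable_ball _ _)) b0.
have := lebesgue_measure_ball (0 : R) (ltW r0); rewrite [LHS]b0 => /eqP.
by rewrite eqe eq_sym mulrn_eq0 /= gt_eqF.
Qed.

Definition shadows (s : seq V) E := foldr shadow E s.

Lemma shadowsS s E F : E `<=` F -> shadows s E `<=` shadows s F.
Proof. by elim: s => //= v s IH EF; apply: shadowS; exact: IH. Qed.

Lemma shadows0 s : shadows s set0 = set0.
Proof. by elim: s => //= v s ->; exact: shadow0. Qed.

Lemma shadows_bigcup s (E : nat -> set V) : shadows s (\bigcup_n E n) `<=` \bigcup_n shadows s (E n).
Proof.
elim: s => //= v s IH x /(@shadowS v _ _ IH); exact: shadow_bigcup.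
Qed.

Lemma measurable_shadows s E : measurable (E : set borelV) -> measurable (shadows s E : set borelV).
Proof. by elim: s => //= v s IH mE; apply: measurable_shadow; exact: IH. Qed.

Lemma shadow_shadows v s E : measurable (E : set borelV) ->
  shadow v (shadows s E) `<=` shadows s (shadow v E).
Proof.
move=> mE; elim: s => //= w s IH.
move=> x /(shadow_comm (measurable_shadows s mE)); exact: (@shadowS w _ _ IH).
Qed.

(** The null direction can be moved to the innermost place by commutation; the
    remaining shadows are then shadows of the empty set. *)
Lemma shadows_null s v E : measurable (E : set borelV) -> v \in s ->
  shadow v E = set0 -> shadows s E = set0.
Proof.
move=> mE + E0; elim: s => //= w s IH; rewrite inE => /predU1P[<-|/IH ->]; last exact: shadow0.
by apply/seteqP; split => // x /(shadow_shadows mE); rewrite E0 shadows0.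
Qed.

Lemma open_shadows s E F : open E -> E `<=` F -> E `<=` shadows s F.
Proof.
move=> oE EF; elim: s => //= v s IH x Ex; apply: (@shadowS v _ _ IH); exact: (open_shadow oE Ex).
Qed.
End NullSets.

(** * Points of common directional differentiability *)

Section GoodPoints.
Context {R : realType} {N : nat}.
Local Notation V := 'rV[R]_N.
Local Notation mu := (@lebesgue_measure R).
Implicit Types (x v w : V) (f : V -> R).

Definition dir_der f x v (l : R) : Prop :=
  forall e, 0 < e -> exists2 d, 0 < d &
    forall t, `|t| <= d -> `|f (x + t *: v) - f x - t * l| <= e * `|t|.

Definition lipV (L : R) f : Prop := forall x y, `|f x - f y| <= L * `|x - y|.

Lemma lipV_gt0 L f : lipV L f -> exists2 K, 0 < K & lipV K f.
Proof.
move=> fL; exists (`|L| + 1); first by rewrite ltr_wpDl.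
move=> x y; rewrite (le_trans (fL x y))// ler_wpM2r//.
by rewrite (le_trans (ler_norm _))// lerDl.
Qed.

Lemma lipV_continuous L f : lipV L f -> continuous f.
Proof.
move=> /lipV_gt0[K K0 fK] x; apply/(@cvgrPdist_le _ _ _ (nbhs x) _ f (f x)) => e e0.
apply/nbhs_ballP; exists (e / K); first by rewrite /= divr_gt0.
move=> y; rewrite -ball_normE /= ltr_pdivlMr// mulrC => /ltW h.
by rewrite (le_trans (fK _ _)).
Qed.

Lemma has_der_line f x v s l :
  has_der (fun t => f (x + t *: v)) s l <-> dir_der f (x + s *: v) v l.
Proof.
by split => h e /h[d d0 dP]; exists d => // t /dP; rewrite scalerDl addrA.
Qed.

Lemma lipschitz_line L f x v : lipV L f ->
  forall s t, `|f (x + s *: v) - f (x + t *: v)| <= L * `|v| * `|s - t|.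
Proof.
move=> fL s t; rewrite (le_trans (fL _ _))//.
rewrite (_ : x + s *: v - (x + t *: v) = (s - t) *: v).
  by rewrite normrZ (mulrC `|s - t|) mulrA.
by rewrite opprD addrACA subrr add0r scalerBl.
Qed.

(** Nonempty intersection of pairwise intersecting intervals: take the supremum
    of the left end points. *)
Lemma nested_point (lo hi : nat -> R) : (forall n m, lo n <= hi m) ->
  exists l, forall n, lo n <= l <= hi n.
Proof.
move=> h; exists (sup (range lo)) => n.
have lu : has_sup (range lo).
  by split; [exists (lo 0%N), 0%N|exists (hi 0%N) => _ [m _ <-]].
apply/andP; split; first by apply: ub_le_sup; [exact: lu.2|exists n].
by apply: sup_le_ub; [exact: lu.1|move=> _ [m _ <-]].
Qed.

Lemma continuous_translate f w : continuous f -> continuous (fun z : V => f (z + w)).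
Proof.
move=> fc z; have h : (z' + w) @[z' --> z] --> z + w.
  exact: (cvgD cvg_id (cvg_cst w)).
exact: (cvg_comp _ _ h (fc (z + w))).
Qed.

Lemma continuous_diff (T : topologicalType) (f g : T -> R) :
  continuous f -> continuous g -> continuous (fun s => f s - g s).
Proof. by move=> fc gc s; apply: cvgB; [exact: fc|exact: gc]. Qed.

Lemma continuous_gap (T : topologicalType) (f g : T -> R) (c : R) :
  continuous f -> continuous g -> continuous (fun s => `|f s - g s - c|).
Proof.
move=> fc gc s; apply: cvg_norm; apply: cvgB; last exact: cvg_cst.
exact: continuous_diff.
Qed.

Definition slope_set v f (a e d : R) : set V :=
  [set x | forall t, `|t| <= d -> `|f (x + t *: v) - f x - t * a| <= e * `|t|].

Lemma closed_slope_set v f a e d : continuous f -> closed (slope_set v f a e d).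
Proof.
move=> fc.
rewrite (_ : slope_set _ _ _ _ _ = \bigcap_(t in [set t | `|t| <= d])
   (fun x => `|f (x + t *: v) - f x - t * a|) @^-1` [set r | r <= e * `|t|]); last first.
  by apply/seteqP; split.
apply: closed_bigI => t _; apply: closed_comp; last exact: closed_le.
move=> x _; apply: (continuous_gap (f := fun x => f (x + t *: v)) (g := f)) => //.
exact: continuous_translate.
Qed.

Definition nondiff v f : set V := [set x | ~ exists l, dir_der f x v l].

(** Countable description of differentiability along v, which makes it Borel.
    Approximate slopes a_n with errors 1 / (n + 1) define intervals around a_n that
    meet pairwise, because two approximations hold on a common scale; a common
    point of these intervals is the derivative. *)
Lemma nondiffE v f :
  ~` nondiff v f = \bigcap_n \bigcup_(q : rat) \bigcup_k
     slope_set v f (ratr q) n.+1%:R^-1 k.+1%:R^-1.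
Proof.
apply/seteqP; split => x /=.
  move=> /contrapT[l fl] n _.
  have e0 : 0 < n.+1%:R^-1 / 2 :> R by rewrite divr_gt0// invr_gt0.
  have [q] := @rat_in_itvoo R (l - n.+1%:R^-1 / 2) (l + n.+1%:R^-1 / 2) ltac:(by rewrite ltrD2l gtrN).
  rewrite in_itv/= => /andP[q1 q2]; exists q => //.
  have [d d0 dP] := fl _ e0.
  have [k kd] := inv_natS_lt d0.
  exists k => // t tk.
  rewrite (_ : _ - _ = (f (x + t *: v) - f x - t * l) + t * (l - ratr q)); last by ring.
  rewrite (le_trans (ler_normD _ _))// [n.+1%:R^-1]splitr mulrDl lerD//.
    by rewrite dP// (le_trans tk)// ltW.
  by rewrite normrM mulrC ler_wpM2r// ler_distlC (ltW q1) (ltW q2).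
move=> h; apply.
have /choice[a aP] : forall n : nat, exists a : R * R, 0 < a.2 /\ slope_set v f a.1 n.+1%:R^-1 a.2 x.
  move=> n; have [q _ [k _ qP]] := h n I.
  by exists (ratr q, k.+1%:R^-1); rewrite /= invr_gt0.
have [l lP] : exists l, forall n, (a n).1 - n.+1%:R^-1 <= l <= (a n).1 + n.+1%:R^-1.
  apply: nested_point => n m.
  have [n0 nP] := aP n; have [m0 mP] := aP m.
  pose t := Num.min (a n).2 (a m).2.
  have t0 : 0 < t by rewrite lt_min n0.
  have := nP t; have := mP t; rewrite (gtr0_norm t0).
  rewrite [t <= (a n).2]ge_min [t <= (a m).2]ge_min !lexx orbT => /(_ isT) + /(_ isT).
  set D := f _ - f _ => h1 h2.
  have : `|t * ((a n).1 - (a m).1)| <= (n.+1%:R^-1 + m.+1%:R^-1) * t.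
    rewrite (_ : t * _ = (D - t * (a m).1) - (D - t * (a n).1)); last by ring.
    apply: (le_trans (ler_normB _ _)); rewrite mulrDl [leRHS]addrC; apply: lerD; [exact: h1|exact: h2].
  rewrite normrM gtr0_norm// mulrC ler_pM2r// => /ler_normlP[_].
  by rewrite lerBlDr => h3; rewrite lerBlDr (le_trans h3)// addrC addrAC addrA.
exists l => e e0.
have [n ne] := inv_natS_lt (divr_gt0 e0 (ltr0n R 2)).
have [n0 nP] := aP n; exists (a n).2 => // t /nP h1.
rewrite (_ : _ - _ = (f (x + t *: v) - f x - t * (a n).1) + t * ((a n).1 - l)); last by ring.
rewrite (le_trans (ler_normD _ _))// (splitr e) mulrDl lerD//.
  by rewrite (le_trans h1)// ler_wpM2r// ltW.
by rewrite normrM mulrC ler_wpM2r// (le_trans _ (ltW ne))// distrC ler_distl lP.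
Qed.

Lemma measurable_nondiff v f : continuous f -> measurable (nondiff v f : set (@borelV R N)).
Proof.
move=> fc; rewrite -(setCK (nondiff v f)); apply: measurableC; rewrite nondiffE.
apply: bigcap_measurableType => n _; apply: bigcupT_measurable_rat => q.
apply: bigcup_measurable => k _; apply: closed_measurableV; exact: closed_slope_set.
Qed.

Lemma shadow_nondiff L v f : lipV L f -> shadow v (nondiff v f) = set0.
Proof.
move=> fL; apply/seteqP; split => // x /=; apply.
have := lipschitz_ae_der (lipschitz_line x v fL).
by apply: negligibleS => t /= h [l]/has_der_line hl; apply: h; exists l.
Qed.

(** Differentiability along the coordinate axes fails on countably many sets
    without shadow along one of the axes. The points near the segment where u
    grows along q at rate at least c have a shadow along q that contains a
    neighbourhood of x, hence an iterated shadow containing x. So they cannot all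
    be bad. Taking q as an additional direction avoids any change of coordinates. *)
Lemma exists_good_point (fs : nat -> V -> R) (u : V -> R) (L t c r : R) x q :
  (forall n, exists K, lipV K (fs n)) -> lipV L u ->
  0 < t -> c * t < u (x + t *: q) - u x -> 0 < r ->
  exists z, [/\ exists2 s, 0 < s < t & `|z - (x + s *: q)| < r,
    forall n k, exists l, dir_der (fs n) z (delta_mx 0 k) l &
    exists2 l, dir_der u z q l & c <= l].
Proof.
move=> fsL uL t0 ct r0.
pose G : set V := [set z | (exists2 s, 0 < s < t & `|z - (x + s *: q)| < r) /\
    exists2 l, dir_der u z q l & c <= l].
pose dirs : seq V := [seq delta_mx 0 k | k <- enum 'I_N].
have uc := lipV_continuous uL.
(* From each point of U, the increment of u along t *: q still exceeds c * t. *)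
pose U : set V := [set z | c * t < u (z + t *: q) - u z] `&` ball x r.
have oU : open U.
  apply: openI; last exact: ball_open.
  have gc : continuous (fun z : V => u (z + t *: q) - u z).
    have h : continuous (fun z : V => u (z + t *: q)) by exact: continuous_translate.
    exact: (continuous_diff h uc).
  apply: (@open_comp _ _ (fun z : V => u (z + t *: q) - u z) [set s : R | c * t < s]).
    by move=> z _; exact: gc.
  exact: open_gt.
have Ux : U x by split => //; exact: ballxx.
have UG : U `<=` shadow q G.
  move=> z [/= uz zx] neg.
  have := @lipschitz_der_ge R (fun s => u (z + s *: q)) (L * `|q|) 0 t c (lipschitz_line z q uL) t0.
  rewrite subr0 scale0r addr0 => /(_ uz); apply; apply: negligibleS neg => s /= [st [l /has_der_line ul cl]].
  split; last by exists l.
  exists s => //; rewrite opprD addrACA subrr addr0 distrC.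
  by move: zx; rewrite -ball_normE.
have GS : shadows (rcons dirs q) G x.
  rewrite /shadows foldr_rcons.
  exact: (open_shadows dirs oU UG Ux).
have mnd n k : measurable (nondiff (delta_mx 0 k) (fs n) : set (@borelV R N)).
  by apply: measurable_nondiff; have [K /lipV_continuous] := fsL n.
have bad0 n k : shadows (rcons dirs q) (nondiff (delta_mx 0 k) (fs n)) = set0.
  apply: (@shadows_null _ _ _ (delta_mx 0 k)) => //.
    by rewrite mem_rcons inE map_f ?orbT// mem_enum.
  by have [K /shadow_nondiff] := fsL n.
(* Coordinates are numbered by nat to obtain a union of sequences of sets. *)
pose Bad : set V := \bigcup_n \bigcup_k
  (if insub k is Some k' then nondiff (delta_mx 0 (k' : 'I_N)) (fs n) else set0).
have BadS : shadows (rcons dirs q) Bad = set0.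
  apply/seteqP; split => // z /shadows_bigcup[n _ /shadows_bigcup[k _]].
  by case: insubP => [k' _ _|_]; rewrite ?bad0 ?shadows0.
have [z [Gz nBz]] : exists z, G z /\ ~ Bad z.
  apply: contrapT => h.
  suff : shadows (rcons dirs q) Bad x by rewrite BadS.
  by apply: shadowsS GS => z Gz; apply: contrapT => nB; apply: h; exists z.
case: Gz => zs ul; exists z; split => // n k.
apply: contrapT => nd; apply: nBz; exists n => //; exists k => //.
by rewrite valK.
Qed.
End GoodPoints.

(** * Gradients and the Euclidean scalar product *)

Section DifferentialEps.
Context {R : realType} {U W : normedModType R}.

Lemma linear_approx_differentiable (f : U -> W) (D : {linear U -> W}) x :
  continuous D ->
  (forall e, 0 < e -> exists2 d, 0 < d &
     forall h, `|h| < d -> `|f (h + x) - f x - D h| <= e * `|h|) ->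
  differentiable f x /\ 'd f x = D :> (U -> W).
Proof.
move=> Dc fD.
have E : f \o shift x = cst (f x) + D +o_ 0 id.
  apply/eqaddoP => e e0; have [d d0 dP] := fD e e0.
  apply/nbhs_ballP; exists d => // h; rewrite -ball_normE /= sub0r normrN => /dP.
  by rewrite !fctE /= opprD addrA.
have dE := diff_unique Dc E.
by split=> //; apply/diff_locallyP; rewrite dE.
Qed.

Lemma differentiable_linear_approx (f : U -> W) x : differentiable f x ->
  forall e, 0 < e -> exists2 d, 0 < d &
     forall h, `|h| < d -> `|f (h + x) - f x - 'd f x h| <= e * `|h|.
Proof.
move=> df e e0; have /diff_locally /eqaddoP /(_ e e0) /nbhs_ballP[d /= d0 dP] := df.
exists d => // h hd; have /dP /= : ball 0 d h by rewrite -ball_normE /= sub0r normrN.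
by rewrite !fctE /= opprD addrA.
Qed.

End DifferentialEps.

Section Dot.
Context {R : realType} {N : nat}.
Local Notation V := 'rV[R]_N.
Implicit Types (a b h p x : V).

Definition dot a b : R := \sum_(k < N) a 0 k * b 0 k.

Lemma dotC a b : dot a b = dot b a.
Proof. by apply: eq_bigr => k _; rewrite mulrC. Qed.

Lemma dotDr p a b : dot p (a + b) = dot p a + dot p b.
Proof. by rewrite -big_split; apply: eq_bigr => k _; rewrite !mxE mulrDr. Qed.

Lemma dotZr p c a : dot p (c *: a) = c * dot p a.
Proof. by rewrite mulr_sumr; apply: eq_bigr => k _; rewrite !mxE mulrCA. Qed.

Lemma dotNr p a : dot p (- a) = - dot p a.
Proof. by rewrite -scaleN1r dotZr mulN1r. Qed.

Lemma dotBr p a b : dot p (a - b) = dot p a - dot p b.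
Proof. by rewrite dotDr dotNr. Qed.

Lemma dotDl p a b : dot (a + b) p = dot a p + dot b p.
Proof. by rewrite dotC dotDr !(dotC p). Qed.

Lemma dotZl p c a : dot (c *: a) p = c * dot a p.
Proof. by rewrite dotC dotZr dotC. Qed.

Lemma dotNl p a : dot (- a) p = - dot a p.
Proof. by rewrite dotC dotNr dotC. Qed.

Lemma dotBl p a b : dot (a - b) p = dot a p - dot b p.
Proof. by rewrite dotDl dotNl. Qed.

Lemma dot0r p : dot p 0 = 0.
Proof. by rewrite -(scale0r 0) dotZr mul0r. Qed.

Lemma dot_delta p k : dot p (delta_mx 0 k) = p 0 k.
Proof.
rewrite /dot (bigD1 k)//= !mxE !eqxx mulr1 big1 ?addr0// => j jk.
by rewrite !mxE (negbTE jk) andbF mulr0.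
Qed.

Lemma normr_dot p h : `|dot p h| <= N%:R * `|p| * `|h|.
Proof.
rewrite (le_trans (ler_norm_sum _ _ _))//.
rewrite (@le_trans _ _ (\sum_(k < N) `|p| * `|h|))//.
  by apply: ler_sum => k _; rewrite normrM ler_pM// le_coord_norm.
by rewrite sumr_const card_ord -mulrA mulr_natl.
Qed.

Definition frechet (u : V -> R) x p : Prop :=
  forall e, 0 < e -> exists2 d, 0 < d &
    forall h, `|h| <= d -> `|u (x + h) - u x - dot p h| <= e * `|h|.

Lemma dot_lipschitz p a b : `|dot p a - dot p b| <= N%:R * `|p| * `|a - b|.
Proof. by rewrite -dotBr normr_dot. Qed.

Lemma frechet_differentiable u x p : frechet u x p -> differentiable u x /\ grad u x = p.
Proof.
move=> up.
have dlin : linear (dot p) by move=> c a b; rewrite dotDr dotZr.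
pose D : {linear V -> R} := HB.pack (dot p) (GRing.isLinear.Build R V R _ (dot p) dlin).
have Dc : continuous D by apply: (@lipV_continuous _ _ (N%:R * `|p|)) => a b; exact: dot_lipschitz.
have [|du dE] := @linear_approx_differentiable _ _ _ u D x Dc.
  move=> e e0; have [d d0 dP] := up e e0; exists d => // h /ltW /dP.
  by rewrite (addrC x).
by split => //; apply/rowP => k; rewrite mxE dE /= dot_delta.
Qed.

Lemma differentiable_frechet u x : differentiable u x -> frechet u x (grad u x).
Proof.
move=> du e e0.
have dE h : 'd u x h = dot (grad u x) h.
  rewrite [in LHS](rowE_delta h) linear_sum; apply: eq_bigr => k _.
  by rewrite linearZ mxE /GRing.scale /= mulrC.
have [d d0 dP] := differentiable_linear_approx du e0.
exists (d / 2); first by rewrite divr_gt0.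
move=> h hd; rewrite -dE (addrC x); apply: dP.
by rewrite (le_lt_trans hd)// ltr_pdivrMr// ltr_pMr// ltr1n.
Qed.

Lemma frechet_dir u x p v : frechet u x p -> dir_der u x v (dot p v).
Proof.
move=> up e e0.
have K0 : 0 < `|v| + 1 by rewrite ltr_wpDl.
have [d d0 dP] := up _ (divr_gt0 e0 K0).
exists (d / (`|v| + 1)); first by rewrite divr_gt0.
move=> t; rewrite ler_pdivlMr// => td.
have := dP (t *: v); rewrite dotZr normrZ => /(_ _)/le_trans; apply.
  by rewrite (le_trans _ td)// ler_wpM2l// lerDl.
by rewrite mulrAC ler_pdivrMr// -!mulrA ler_wpM2l ?(ltW e0)// ler_wpM2l// lerDl.
Qed.

Lemma dir_der_unique u x v l l' : dir_der u x v l -> dir_der u x v l' -> l = l'.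
Proof.
move=> h h'; apply/eqP/negPn/negP => ll'.
have e0 : 0 < `|l - l'| / 3 by rewrite divr_gt0// normr_gt0 subr_eq0.
have [d d0 dP] := h _ e0; have [d' d'0 dP'] := h' _ e0.
pose t := Num.min d d'.
have t0 : 0 < t by rewrite lt_min d0.
have := dP t; have := dP' t; rewrite (gtr0_norm t0).
rewrite [t <= d]ge_min [t <= d']ge_min !lexx orbT => /(_ isT) + /(_ isT).
set D := u _ - u _ => h1 h2.
have : `|t * (l - l')| <= 2 * (`|l - l'| / 3) * t.
  rewrite (_ : t * _ = (D - t * l') - (D - t * l)); last by ring.
  by rewrite (le_trans (ler_normB _ _))// mulr_natl mulr2n mulrDl lerD.
rewrite normrM (gtr0_norm t0) mulrC ler_pM2r//.
by move: e0 => /=; lra.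
Qed.

End Dot.

(** * Rademacher's theorem *)

Section Rademacher.
Context {R : realType} {N : nat}.
Local Notation V := 'rV[R]_N.
Variables (u : V -> R) (L : R).
Hypotheses (L_gt0 : 0 < L) (uL : lipV L u).
Implicit Types (x z h : V) (E : set V).

Definition gap E x : R := inf [set `|x - z| | z in E].

Lemma gap_ge0 E x : 0 <= gap E x.
Proof.
have [E0|/nonemptyPn E0] := pselect ([set `|x - z| | z in E] !=set0).
  by apply: lb_le_inf => // _ [z _ <-].
by rewrite /gap E0 inf0.
Qed.

Lemma gap_le E x z : E z -> gap E x <= `|x - z|.
Proof. by move=> Ez; apply: ge_inf; [exists 0 => _ [w _ <-]|exists z]. Qed.

Lemma gap_mem E x : E x -> gap E x = 0.
Proof.
by move=> Ex; have := gap_le x Ex; rewrite subrr normr0 => g0; apply/le_anti; rewrite g0 gap_ge0.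
Qed.

Lemma gap_lt E x r : E !=set0 -> gap E x < r -> exists2 z, E z & `|x - z| < r.
Proof.
move=> [w Ew] gr; have [|_ [z Ez <-] zr] := @inf_lt R [set `|x - z| | z in E] r _ gr.
  by exists `|x - w|, w.
by exists z.
Qed.

Lemma gap_lipschitz E : lipV 1 (gap E).
Proof.
move=> x y; rewrite mul1r.
have [[w Ew]|/nonemptyPn E0] := pselect (E !=set0); last first.
  by rewrite E0 /gap !image_set0 subrr normr0.
have aux a b : gap E a - gap E b <= `|a - b|.
  rewrite lerBlDr -lerBlDl; apply: lb_le_inf; first by exists `|b - w|, w.
  move=> _ [z Ez <-]; rewrite lerBlDl (le_trans (gap_le _ Ez))//.
  exact: ler_distD.
by rewrite ler_norml aux andbT lerNl opprB distrC aux.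
Qed.

(** Slopes are rational, errors and scales are inverses of integers, so that
    these sets form a countable family. *)
Definition affine_set (n : nat) (a : 'rV[rat]_N) (i j : nat) : set V :=
  [set x | forall h : V, (forall k : 'I_N, (n <= k)%N -> h 0 k = 0) -> `|h| <= j.+1%:R^-1 ->
     `|u (x + h) - u x - dot (map_mx ratr a) h| <= i.+1%:R^-1 * `|h| ].

(** A countable family whose partial differentiability at a point forces the
    differentiability of u there: u and the distances to all the affine sets. *)
Definition test_funs (p : nat) : V -> R :=
  if p is p'.+1 then
    if @unpickle (nat * 'rV[rat]_N * nat * nat)%type p' is Some (n, a, i, j)
    then gap (affine_set n a i j) else u
  else u.

Lemma test_funs_lipschitz p : exists K, lipV K (test_funs p).
Proof.
case: p => [|p]; first by exists L.
rewrite /=; case: unpickle => [[[[n a] i] j]|]; last by exists L.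
by exists 1; exact: gap_lipschitz.
Qed.

(** By induction on the number of coordinates. Let z belong to the affine set E
    for the first n coordinates. The distance to E is minimal at z, so its partial
    derivative along the next axis is 0: moving by t along this axis stays within
    o(t) of E. There u has the affine approximation of E in the first n
    coordinates, and its partial derivative at z accounts for the move itself.
    Only distances to sets are needed, in place of Lebesgue density. *)
Lemma partial_approx z : (forall p k, exists l, dir_der (test_funs p) z (delta_mx 0 k) l) ->
  forall n, (n <= N)%N -> forall i, exists a j, affine_set n a i j z.
Proof.
move=> zd; elim=> [|n IH] nN i.
  exists 0, 0%N => h h0 _.
  have -> : h = 0 by apply/rowP => k; rewrite mxE h0.
  by rewrite addr0 subrr dot0r subrr !normr0 mulr0.
have e0 : 0 < i.+1%:R^-1 / (4 * L + 4) :> R.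
  by rewrite divr_gt0// ?invr_gt0// addr_gt0// mulr_gt0.
(* The five error terms below add up to at most (4 * L + 3) * e * |h|. *)
set e := _ / _ in e0.
have [i1 i1e] := inv_natS_lt e0.
have [a [j az]] := IH (ltnW nN) i1.
pose k0 := Ordinal nN.
have [l ul] := zd 0%N k0.
have [q] := @rat_in_itvoo R (l - e) (l + e) ltac:(by rewrite ltrD2l gtrN).
rewrite in_itv/= => /andP[q1 q2].
have lq : `|l - ratr q| <= e by rewrite ler_distlC (ltW q1) (ltW q2).
pose E := affine_set n a i1 j.
have [m ml] := zd (pickle (n, a, i1, j)).+1 k0.
rewrite /= pickleK in ml.
(* gap E vanishes at z and is nonnegative, so m is 0. *)
have m0 : m = 0.
  have gz0 : gap E z = 0 by exact: gap_mem.
  apply/eqP/negPn/negP => m0.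
  have m20 : 0 < `|m| / 2 by rewrite divr_gt0// normr_gt0.
  have [d d0 dP] := ml _ m20.
  have := dP d; have := dP (- d); rewrite normrN (gtr0_norm d0) lexx gz0 !subr0.
  move=> /(_ isT)/ler_normlP[_ g1] /(_ isT)/ler_normlP[_ g2].
  have := gap_ge0 E (z + d *: delta_mx 0 k0); have := gap_ge0 E (z + - d *: delta_mx 0 k0).
  move: m0 m20 g1 g2; rewrite neq_lt => /orP[mn|mp].
    by rewrite (ltr0_norm mn) => *; nra.
  by rewrite (gtr0_norm mp) => *; nra.
have [d1 d10 d1P] := ul _ e0.
have [d2 d20 d2P] := ml _ e0.
pose d := Num.min (Num.min d1 d2) (j.+1%:R^-1).
have d0 : 0 < d by rewrite !lt_min d10 d20 invr_gt0 ltr0Sn.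
have [j' j'd] := inv_natS_lt d0.
exists (\row_k if k == k0 then q else a 0 k), j' => h hn hj'.
have hd : `|h| <= d by rewrite (le_trans hj')// ltW.
move: (hd); rewrite !le_min -andbA => /and3P[hd1 hd2 hdj].
pose t := h 0 k0.
have th : `|t| <= `|h| by exact: le_coord_norm.
pose h' := h - t *: delta_mx 0 k0.
have h'k k : h' 0 k = if k == k0 then 0 else h 0 k.
  by rewrite !mxE eqxx /= /t; have [->|kk] := eqVneq k k0; rewrite ?mulr1 ?mulr0 ?subrr ?subr0.
have h'h : `|h'| <= `|h|.
  apply: norm_le_coord => // k; rewrite h'k; case: eqP => _; first by rewrite normr0.
  exact: le_coord_norm.
have h'n (k : 'I_N) : (n <= k)%N -> h' 0 k = 0.
  rewrite h'k; case: eqP => // kk nk; apply: hn; rewrite ltn_neqAle nk andbT.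
  by apply/eqP => nk'; apply: kk; apply: val_inj.
have [w Ew wz] : exists2 w, E w & `|z + t *: delta_mx 0 k0 - w| <= 2 * e * `|t|.
  have [t0|t0] := eqVneq t 0.
    by exists z => //; rewrite t0 scale0r addr0 subrr !normr0 mulr0.
  have := d2P t (le_trans th hd2); rewrite (gap_mem az) m0 mulr0 !subr0 => /ler_normlP[_ gt].
  have [|w Ew wt] := @gap_lt E (z + t *: delta_mx 0 k0) (2 * e * `|t|) (ex_intro _ z az).
    rewrite (le_lt_trans gt)// -mulrA mulr_natl mulr2n ltrDl mulr_gt0// normr_gt0//.
  by exists w => //; exact: ltW.
have dotE : dot (map_mx ratr (\row_k if k == k0 then q else a 0 k)) h =
    dot (map_mx ratr a) h' + t * ratr q :> R.
  rewrite /dot (bigD1 k0)//= [in RHS](bigD1 k0)//= h'k eqxx mulr0 add0r [RHS]addrC.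
  congr (_ + _); first by rewrite !mxE eqxx mulrC.
  by apply: eq_bigr => k kk; rewrite h'k (negbTE kk) !mxE (negbTE kk).
rewrite dotE.
have hE : z + h = (z + t *: delta_mx 0 k0) + h' by rewrite /h' addrC -!addrA [X in _ = _ + X]addrC subrK addrC.
set z1 := z + t *: delta_mx 0 k0 in wz hE *.
have b1 : `|u (z1 + h') - u (w + h')| <= L * (2 * e * `|h|).
  apply: (le_trans (uL _ _)); rewrite ler_wpM2l ?(ltW L_gt0)//.
  have -> : z1 + h' - (w + h') = z1 - w by rewrite opprD addrACA subrr addr0.
  by rewrite (le_trans wz)// ler_wpM2l// mulr_ge0// ltW.
have b2 : `|u w - u z1| <= L * (2 * e * `|h|).
  apply: (le_trans (uL _ _)); rewrite ler_wpM2l ?(ltW L_gt0)// distrC (le_trans wz)//.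
  by rewrite ler_wpM2l// mulr_ge0// ltW.
have b3 : `|u (w + h') - u w - dot (map_mx ratr a) h'| <= e * `|h|.
  rewrite (le_trans (Ew _ h'n (le_trans h'h hdj)))// ler_pM// ?invr_ge0//; exact: ltW.
have b4 : `|u z1 - u z - t * l| <= e * `|h|.
  by rewrite (le_trans (d1P _ (le_trans th hd1)))// ler_wpM2l// ltW.
have b5 : `|t * (l - ratr q)| <= e * `|h|.
  by rewrite normrM mulrC ler_pM.
rewrite hE.
have -> : u (z1 + h') - u z - (dot (map_mx ratr a) h' + t * ratr q) =
  (u (z1 + h') - u (w + h')) + (u (w + h') - u w - dot (map_mx ratr a) h') + (u w - u z1)
  + (u z1 - u z - t * l) + t * (l - ratr q) by ring.
have E5 (A B C D F : R) : `|A + B + C + D + F| <= `|A| + `|B| + `|C| + `|D| + `|F|.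
  by do 4 (rewrite (le_trans (ler_normD _ _))// ?lerD2r).
rewrite (le_trans (E5 _ _ _ _ _))//.
have -> : i.+1%:R^-1 = (4 * L + 4) * e.
  rewrite /e mulrC divfK// gt_eqF// addr_gt0// mulr_gt0//.
have : 0 <= e * `|h| by rewrite mulr_ge0// ltW.
move: b1 b2 b3 b4 b5; rewrite !(mulrCA L).
by move=> *; nra.
Qed.

Lemma norm_delta (k : 'I_N) (t : R) : `|t *: (delta_mx 0 k : V)| <= `|t|.
Proof.
apply: norm_le_coord => // j; rewrite !mxE eqxx /=.
by case: eqP; rewrite ?mulr1 ?mulr0 ?normr0.
Qed.

(** At every precision e there is an affine approximation; its slope differs from
    the partial derivatives by at most 2 * e, so the latter form the gradient. *)
Lemma partials_frechet z :
  (forall p k, exists l, dir_der (test_funs p) z (delta_mx 0 k) l) -> exists p, frechet u z p.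
Proof.
move=> zd; have /choice[l ul] := zd 0%N; exists (\row_k l k) => e e0.
have K0 : 0 < 2 * N%:R + 1 :> R by rewrite ltr_wpDl// mulr_ge0.
have [i ie] := inv_natS_lt (divr_gt0 e0 K0).
have i0 : 0 < i.+1%:R^-1 :> R by rewrite invr_gt0.
have [a [j az]] := partial_approx zd (leqnn N) i.
have {}az h : `|h| <= j.+1%:R^-1 -> `|u (z + h) - u z - dot (map_mx ratr a) h| <= i.+1%:R^-1 * `|h|.
  by apply: az => k; rewrite leqNgt ltn_ord.
have j0 : 0 < j.+1%:R^-1 :> R by rewrite invr_gt0.
exists j.+1%:R^-1 => // h hj.
have al k : `|ratr (a 0 k) - l k| <= 2 * i.+1%:R^-1.
  have [d d0 dP] := ul k _ i0.
  pose t := Num.min d j.+1%:R^-1; have t0 : 0 < t by rewrite lt_min d0.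
  have td : `|t| <= d by rewrite gtr0_norm// ge_min lexx.
  have tj : `|t| <= j.+1%:R^-1 by rewrite gtr0_norm// ge_min lexx orbT.
  have := dP _ td; have := az (t *: delta_mx 0 k) (le_trans (norm_delta _ _) tj).
  rewrite dotZr dot_delta mxE; set D := u _ - u _ => h1 h2.
  have h3 : `|D - t * ratr (a 0 k)| <= i.+1%:R^-1 * `|t|.
    by rewrite (le_trans h1)// ler_wpM2l ?(ltW i0)// norm_delta.
  have : `|t * (ratr (a 0 k) - l k)| <= 2 * i.+1%:R^-1 * `|t|.
    rewrite (_ : t * _ = (D - t * l k) - (D - t * ratr (a 0 k))); last by ring.
    by rewrite (le_trans (ler_normB _ _))// mulr_natl mulr2n mulrDl lerD.
  by rewrite normrM mulrC ler_pM2r// gtr0_norm.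
have := az _ hj; set D := u _ - u _ => h1.
rewrite (_ : D - _ = (D - dot (map_mx ratr a) h) + dot (map_mx ratr a - \row_k l k) h); last first.
  by rewrite dotBl; ring.
rewrite (le_trans (ler_normD _ _))//.
have h2 : `|dot (map_mx ratr a - \row_k l k) h| <= N%:R * (2 * i.+1%:R^-1) * `|h|.
  rewrite (le_trans (normr_dot _ _))// ler_wpM2r// ler_wpM2l//.
  apply: norm_le_coord; first by rewrite mulr_ge0// ltW.
  by move=> k; rewrite !mxE.
rewrite (le_trans (lerD h1 h2))// -mulrDl ler_wpM2r//.
have : i.+1%:R^-1 * (2 * N%:R + 1) <= e by rewrite -ler_pdivlMr// ltW.
by apply: le_trans; rewrite le_eqVlt; apply/orP; left; apply/eqP; ring.
Qed.

(** Rademacher's theorem with a direction: differentiability points can be found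
    where the derivative along q is as large as a given mean slope of u. *)
Lemma exists_frechet_ge (t c r : R) x q :
  0 < t -> c * t < u (x + t *: q) - u x -> 0 < r ->
  exists z p, [/\ exists2 s, 0 < s < t & `|z - (x + s *: q)| < r, frechet u z p & c <= dot p q].
Proof.
move=> t0 ct r0.
have [z [zs zd [l ul cl]]] := exists_good_point test_funs_lipschitz uL t0 ct r0.
have [p zp] := partials_frechet zd.
by exists z, p; split => //; rewrite (dir_der_unique (frechet_dir q zp) ul).
Qed.
End Rademacher.

(** * Quadratic test functions *)

Lemma continuous_affine (R : realType) (U : normedModType R) (p x : U) (c : R) :
  continuous (fun y : U => p + c *: (y - x)).
Proof.
move=> y; apply: cvgD; first exact: cvg_cst.
by apply: cvgZ; [exact: cvg_cst|apply: cvgB; [exact: cvg_id|exact: cvg_cst]].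
Qed.

Lemma continuous_dist (R : realType) (U : normedModType R) (x : U) :
  continuous (fun y : U => `|y - x|).
Proof. by move=> y; apply: cvg_norm; apply: cvgB; [exact: cvg_id|exact: cvg_cst]. Qed.

Lemma continuous_normr (R : realType) (T : topologicalType) (f : T -> R) :
  continuous f -> continuous (fun s => `|f s|).
Proof. by move=> fc s; apply: cvg_norm; exact: fc. Qed.

Section Quadratic.
Context {R : realType} {N : nat}.
Local Notation V := 'rV[R]_N.
Implicit Types (x z p h : V) (u : V -> R).

Definition sqn x : R := dot x x.

Lemma sqn_ge0 x : 0 <= sqn x.
Proof. by apply: sumr_ge0 => k _; rewrite -expr2 sqr_ge0. Qed.

Lemma sqnD x z : sqn (x + z) = sqn x + 2 * dot x z + sqn z.
Proof. by rewrite /sqn dotDr !dotDl (dotC z x); ring. Qed.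

Lemma sqnN x : sqn (- x) = sqn x.
Proof. by rewrite /sqn dotNr dotNl opprK. Qed.

Lemma sqnB x z : sqn (x - z) = sqn x - 2 * dot x z + sqn z.
Proof. by rewrite sqnD sqnN dotNr; ring. Qed.

Lemma sqnZ c x : sqn (c *: x) = c ^+ 2 * sqn x.
Proof. by rewrite /sqn dotZl dotZr; ring. Qed.

Lemma sqn0 : sqn 0 = 0.
Proof. by rewrite /sqn dot0r. Qed.

Lemma sqr_norm_le_sqn x : `|x| ^+ 2 <= sqn x.
Proof.
have -> : `|x| ^+ 2 = `| `|x| | ^+ 2 by rewrite normr_id.
have s0 := sqn_ge0 x.
rewrite -[sqn x]sqr_sqrtr// ler_pXn2r ?nnegrE ?sqrtr_ge0// normr_id.
apply: norm_le_coord; first exact: sqrtr_ge0.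
move=> k; rewrite -sqrtr_sqr ler_sqrt// /sqn /dot (bigD1 k)//= -expr2 lerDl.
by apply: sumr_ge0 => j _; rewrite -expr2 sqr_ge0.
Qed.

Lemma sqn_le_sqr_norm x : sqn x <= N%:R * `|x| ^+ 2.
Proof.
by rewrite (le_trans (ler_norm _))// (le_trans (normr_dot _ _))// expr2 mulrA.
Qed.

Lemma norm_le_enorm x : `|x| <= enorm x.
Proof.
have -> : enorm x = Num.sqrt (sqn x).
  by congr Num.sqrt; apply: eq_bigr => k _; rewrite expr2.
by rewrite -[leLHS]ger0_norm// -sqrtr_sqr ler_sqrt ?sqn_ge0// sqr_norm_le_sqn.
Qed.

(** Quadratic functions are the only test functions used to produce elements of
    super- and subdifferentials. *)
Definition quad p (a : R) x z : R := dot p (z - x) + a * sqn (z - x).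

Lemma quad_frechet p a x z : frechet (quad p a x) z (p + (2 * a) *: (z - x)).
Proof.
move=> e e0.
have K0 : 0 < `|a| * N%:R + 1 by rewrite ltr_wpDl// mulr_ge0.
exists (e / (`|a| * N%:R + 1)); first by rewrite divr_gt0.
move=> h; rewrite ler_pdivlMr// => he.
rewrite (_ : _ - _ = a * sqn h); last first.
  by rewrite /quad (addrAC z) (sqnD (z - x)) (dotDr p (z - x)) (dotDl h p) dotZl; ring.
rewrite normrM (ger0_norm (sqn_ge0 h)).
rewrite (le_trans (ler_wpM2l (normr_ge0 a) (sqn_le_sqr_norm h)))//.
rewrite expr2 !mulrA ler_wpM2r// (le_trans _ he)// mulrDr mulr1 mulrC lerDl//.
Qed.

Lemma quad_C1 p a x z : C1_near (quad p a x) z.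
Proof.
have gE y : grad (quad p a x) y = p + (2 * a) *: (y - x).
  by have [_ ->] := frechet_differentiable (@quad_frechet p a x y).
near=> y; split; first by have [] := frechet_differentiable (@quad_frechet p a x y).
have -> : grad (quad p a x) = (fun y => p + (2 * a) *: (y - x)) by apply/funext.
exact: continuous_affine.
Unshelve. all: by end_near. Qed.

Lemma grad_quad p a x : grad (quad p a x) x = p.
Proof.
by have [_ ->] := frechet_differentiable (@quad_frechet p a x x); rewrite subrr scaler0 addr0.
Qed.

Lemma quad_center p a x : quad p a x x = 0.
Proof. by rewrite /quad subrr dot0r sqn0 mulr0 addr0. Qed.

Lemma superdiff_quad u x p a :
  (\forall z \near x, u z <= u x + quad p a x z) -> superdiff u x p.
Proof.
move=> uq; exists (quad p a x); split; [exact: quad_C1| |by rewrite grad_quad].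
by apply: filterS uq => z; rewrite quad_center subr0 lerBlDr.
Qed.

Lemma subdiff_quad u x p a :
  (\forall z \near x, u x + quad p a x z <= u z) -> subdiff u x p.
Proof.
move=> uq; exists (quad p a x); split; [exact: quad_C1| |by rewrite grad_quad].
by apply: filterS uq => z; rewrite quad_center subr0 lerBrDr.
Qed.

Lemma superdiff_le u x p : superdiff u x p ->
  forall e, 0 < e -> exists2 d, 0 < d &
    forall h, `|h| <= d -> u (x + h) <= u x + dot p h + e * `|h|.
Proof.
move=> [phi [/nbhs_singleton[/differentiable_frechet + _] uphi ->]] e e0.
move=> /(_ e e0)[d d0 dP].
move: uphi => /nbhs_ballP[d' /= d'0 d'P].
exists (Num.min d (d' / 2)); first by rewrite lt_min d0 divr_gt0.
move=> h; rewrite le_min => /andP[/dP h1 h2].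
have /d'P : ball x d' (x + h).
  rewrite -ball_normE /= opprD addrA subrr sub0r normrN (le_lt_trans h2)//.
  by rewrite ltr_pdivrMr// ltr_pMr// ltr1n.
by move: h1 => /ler_normlP[_]; lra.
Qed.

Lemma closed_ball_compact x r : compact [set z : V | `|z - x| <= r].
Proof.
apply: bounded_closed_compact.
  exists (r + `|x|); split; first by rewrite num_real.
  move=> M Mr z /= zA; rewrite -(subrK x z) (le_trans (ler_normD _ _))//.
  by rewrite (le_trans _ (ltW Mr))// lerD2r.
rewrite (_ : [set _ | _] = (fun z => `|z - x|) @^-1` [set s | s <= r]); last by [].
by apply: closed_comp; [move=> z _; exact: continuous_dist|exact: closed_le].
Qed.

Lemma ball_compact r : compact [set z : V | `|z| <= r].
Proof.
rewrite (_ : [set _ | _] = [set z : V | `|z - 0| <= r]); first exact: closed_ball_compact.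
by apply/seteqP; split=> z /=; rewrite subr0.
Qed.

(** Only a closed ball matters, and closed balls are compact. *)
Lemma max_coercive (f : V -> R) x r : continuous f ->
  (forall z, r < `|z - x| -> f z <= f x) -> exists z, forall z', f z' <= f z.
Proof.
move=> fc fr; pose r' := Num.max r 0.
pose A := [set z : V | `|z - x| <= r'].
have cA : compact A by exact: closed_ball_compact.
have Ax : A x by rewrite /A /= subrr normr0 le_max lexx orbT.
have [|z _ zP] := EVT_max_rV (ex_intro _ x Ax) cA (f := f).
  exact: continuous_subspaceT.
exists z => z'; have [Az'|Az'] := leP `|z' - x| r'; first by apply: zP; rewrite inE.
apply: (le_trans (fr _ _)); last by apply: zP; rewrite inE.
by rewrite (le_lt_trans _ Az')// le_max lexx.
Qed.

Lemma cube_reduce x : exists k : 'rV[int]_N, `|x + map_mx intr k| <= 1.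
Proof.
exists (\row_k - Num.floor (x 0 k)); apply: norm_le_coord => // k.
rewrite !mxE mulrNz.
have /andP[h1 h2] := floor_itv (x 0 k).
rewrite ger0_norm ?subr_ge0// lerBlDr.
by move: h2; rewrite intrD addrC => /ltW.
Qed.

Lemma torus_bounded u : torus_continuous u -> exists2 M, 0 <= M & forall x, `|u x| <= M.
Proof.
move=> [uc up].
have [||z _ zP] := EVT_max_rV _ (@ball_compact 1) (f := fun z => `|u z|).
- by exists 0; rewrite /= normr0.
- by apply: continuous_subspaceT; exact: continuous_normr.
exists `|u z| => // x; have [k xk] := cube_reduce x.
by rewrite -(up k x); apply: zP; rewrite inE.
Qed.

End Quadratic.

(** * Sup-convolution and Lipschitz bounds *)

Section SupConvolution.
Context {R : realType} {N : nat}.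
Local Notation V := 'rV[R]_N.
Variables (u : V -> R) (M : R).
Hypotheses (uc : continuous u) (uM : forall x, `|u x| <= M).
Implicit Types (x y z p h : V) (e : R).

(** The maximum over z is the sup-convolution of u at x, and its maximizers z
    carry the superdifferential (z - x) / e of u. *)
Definition penal e x z : R := u z - quad 0 (2 * e)^-1 x z.

Lemma quad_continuous p a x : continuous (quad p a x : V -> R).
Proof.
move=> z; apply: differentiable_continuous.
by have [] := frechet_differentiable (@quad_frechet R N p a x z).
Qed.

Lemma quad0E (a : R) x z : quad 0 a x z = a * sqn (z - x).
Proof. by rewrite /quad dotC dot0r add0r. Qed.

Definition prox e x : V := get (fun z => forall z', penal e x z' <= penal e x z).

Lemma penal_self e x : penal e x x = u x.
Proof. by rewrite /penal quad_center subr0. Qed.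

Lemma sup_bound_ge0 : 0 <= M.
Proof. exact: le_trans (uM 0). Qed.

(** At distance more than 1 + 4 * M * e the penalty exceeds 2 * M, which bounds
    the oscillation of u. *)
Lemma proxP e x : 0 < e -> forall z, penal e x z <= penal e x (prox e x).
Proof.
move=> e0; apply: (@getPex _ (fun z => forall z', penal e x z' <= penal e x z)).
apply: (@max_coercive _ _ _ x (1 + 4 * M * e)).
  by apply: continuous_diff; [exact: uc|exact: quad_continuous].
move=> z zx; rewrite penal_self /penal quad0E.
have M0 := sup_bound_ge0; have Me : 0 <= 4 * M * e by rewrite !mulr_ge0// ltW.
have s4 : 4 * M * e <= sqn (z - x).
  by rewrite (le_trans _ (sqr_norm_le_sqn _))//; nra.
have : (2 * e)^-1 * (4 * M * e) <= (2 * e)^-1 * sqn (z - x).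
  by rewrite ler_wpM2l// invr_ge0 mulr_ge0// ltW.
rewrite (_ : (2 * e)^-1 * (4 * M * e) = 2 * M); last by field; rewrite gt_eqF.
by have /ler_normlP := uM x; have /ler_normlP := uM z; move=> [] ? ? [] ? ?; lra.
Qed.

Lemma prox_near e x : 0 < e -> sqn (prox e x - x) <= 4 * M * e.
Proof.
move=> e0; have := proxP x e0 x; rewrite penal_self /penal quad0E => h.
have : (2 * e)^-1 * sqn (prox e x - x) <= 2 * M.
  have /ler_normlP := uM x; have /ler_normlP := uM (prox e x); move=> [] ? ? [] ? ?; lra.
by rewrite ler_pdivrMl ?mulr_gt0//; lra.
Qed.

Lemma prox_superdiff e x : 0 < e -> superdiff u (prox e x) (e^-1 *: (prox e x - x)).
Proof.
move=> e0; set z := prox e x; apply: (@superdiff_quad _ _ _ _ _ (2 * e)^-1).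
near=> w; have := proxP x e0 w; rewrite -/z /penal !quad0E /quad.
rewrite (_ : w - x = (z - x) + (w - z)); last by rewrite [RHS]addrC subrKA.
rewrite sqnD dotZl => h.
have : (2 * e)^-1 * (2 * dot (z - x) (w - z)) = e^-1 * dot (z - x) (w - z) by field; rewrite gt_eqF.
by move=> E; move: h; rewrite !mulrDr E; lra.
Unshelve. all: by end_near. Qed.

Definition supconv e x : R := penal e x (prox e x).

Lemma supconv_ge e x : 0 < e -> u x <= supconv e x.
Proof. by move=> e0; have := proxP x e0 x; rewrite penal_self. Qed.

Lemma supconv_le e x : 0 < e -> supconv e x <= u (prox e x).
Proof.
move=> e0; rewrite /supconv /penal quad0E lerBlDr lerDl mulr_ge0 ?sqn_ge0//.
by rewrite invr_ge0 mulr_ge0// ltW.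
Qed.

Section Slope.
Variable k : R.
Hypothesis uk : forall z p, superdiff u z p -> `|p| <= k.

Lemma superdiff_bound_ge0 : 0 <= k.
Proof. by apply: le_trans (uk (prox_superdiff 0 ltr01)). Qed.

Lemma prox_le e x : 0 < e -> `|prox e x - x| <= k * e.
Proof.
move=> e0; have := uk (prox_superdiff x e0); rewrite normrZ (@gtr0_norm _ e^-1) ?invr_gt0//.
by rewrite ler_pdivrMl// mulrC.
Qed.

(** Testing the maximum at y with the maximizer of x: the first order term is the
    superdifferential at that maximizer, whose norm is at most k. *)
Lemma supconv_diff e x y : 0 < e ->
  supconv e x - supconv e y <= N%:R * k * `|x - y| + N%:R * (2 * e)^-1 * `|x - y| ^+ 2.
Proof.
move=> e0; set z := prox e x.
have h : penal e y z <= supconv e y by exact: proxP.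
apply: (@le_trans _ _ (penal e x z - penal e y z)); first by rewrite lerD2l lerN2.
rewrite /penal !quad0E.
rewrite (_ : z - y = (z - x) + (x - y)); last by rewrite subrKA.
rewrite (sqnD (z - x)).
set a := (2 * e)^-1; have a0 : 0 < a by rewrite invr_gt0 mulr_gt0.
have h1 : a * (2 * dot (z - x) (x - y)) <= N%:R * k * `|x - y|.
  rewrite (_ : a * _ = dot (e^-1 *: (z - x)) (x - y)); last first.
    by rewrite dotZl /a; field; rewrite gt_eqF.
  rewrite (le_trans (ler_norm _))// (le_trans (normr_dot _ _))// ler_wpM2r// ler_wpM2l//.
  exact: uk (prox_superdiff x e0).
have h2 : a * sqn (x - y) <= N%:R * a * `|x - y| ^+ 2.
  by rewrite -mulrA mulrCA ler_wpM2l ?(ltW a0)// sqn_le_sqr_norm.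
move: h1 h2; rewrite !mulrDr; lra.
Qed.

End Slope.
End SupConvolution.

Section Subdivision.
Context {R : realType} {U : normedModType R}.

(** Cut the segment from x to y into n equal pieces: the quadratic terms add up
    to O(1 / n). *)
Lemma lipschitz_of_local (f : U -> R) (K C : R) : 0 <= C ->
  (forall x y, f x - f y <= K * `|x - y| + C * `|x - y| ^+ 2) ->
  forall x y, f x - f y <= K * `|x - y|.
Proof.
move=> C0 fKC x y.
have step (w : U) (n : nat) : f (y + w *+ n) - f y <= (K * `|w| + C * `|w| ^+ 2) *+ n.
  elim: n => [|n IH]; first by rewrite !mulr0n addr0 subrr.
  have := fKC (y + w *+ n.+1) (y + w *+ n).
  rewrite mulrS opprD addrACA subrr add0r addrK => h.
  by rewrite [leRHS]mulrS; move: h IH; lra.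
apply/ler_addgt0Pr => e e0.
set d := `|x - y|.
have [n nP] : exists n : nat, C * d ^+ 2 / e < n.+1%:R by exists (Num.truncn (C * d ^+ 2 / e)); rewrite truncnS_gt.
have n0 : 0 < n.+1%:R :> R by [].
have := step (n.+1%:R^-1 *: (x - y)) n.+1.
have -> : y + (n.+1%:R^-1 *: (x - y)) *+ n.+1 = x.
  by rewrite -scaler_nat scalerA divff ?pnatr_eq0// scale1r addrC subrK.
rewrite normrZ ger0_norm ?invr_ge0// -/d -mulr_natl.
move/le_trans; apply.
set nn := n.+1%:R in n0 nP *.
rewrite (_ : _ * _ = K * d + C * d ^+ 2 / nn); last by field; rewrite gt_eqF.
by rewrite lerD2l ler_pdivrMr// [leRHS]mulrC -ler_pdivrMr// ltW.
Qed.
End Subdivision.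

Section SuperdiffBound.
Context {R : realType} {N : nat}.
Local Notation V := 'rV[R]_N.
Variables (u : V -> R) (M k : R).
Hypotheses (uc : continuous u) (uM : forall x, `|u x| <= M).
Hypothesis uk : forall z p, superdiff u z p -> `|p| <= k.

Lemma supconv_lipschitz e : 0 < e -> lipV (N%:R * k) (supconv u e).
Proof.
move=> e0 x y.
have C0 : 0 <= N%:R * (2 * e)^-1 by rewrite mulr_ge0// invr_ge0 mulr_ge0// ltW.
have h := lipschitz_of_local C0 (fun x y => supconv_diff uc uM uk x y e0).
by rewrite ler_norml lerNl opprB h andbT distrC h.
Qed.

(** The sup-convolutions are Lipschitz with a constant independent of e and
    converge to u when e tends to 0. *)
Lemma superdiff_bound_lipschitz : lipV (N%:R * k) u.
Proof.
suff h x y : u x - u y <= N%:R * k * `|x - y|.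
  by move=> x y; rewrite ler_norml lerNl opprB h andbT distrC h.
have k0 : 0 <= k := superdiff_bound_ge0 uc uM uk.
apply/ler_addgt0Pr => e e0.
have /cvgrPdist_le /(_ e e0) /nbhs_ballP[d /= d0 dP] := @uc y.
pose r := d / (k + 1) / 2.
have k10 : 0 < k + 1 by rewrite ltr_wpDl.
have r0 : 0 < r by rewrite !divr_gt0.
have zy : `|prox u r y - y| < d.
  rewrite (le_lt_trans (prox_le uc uM uk y r0))// /r mulrA ltr_pdivrMr// mulrCA.
  have : k / (k + 1) <= 1 by rewrite ler_pdivrMr// mul1r lerDl.
  by nra.
have /dP : ball y d (prox u r y) by rewrite -ball_normE /= distrC.
move=> /ler_normlP[h1 h2].
have := supconv_ge uc uM x r0; have := supconv_le u y r0.
have := supconv_lipschitz r0 x y => /ler_normlP[_].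
by lra.
Qed.
End SuperdiffBound.

(** * Oscillation bounds from irreducible couplings *)

Lemma finite_uniform_bound (R : realType) (T : finType) (P : T -> R -> Prop) :
  (forall i c c', c <= c' -> P i c -> P i c') -> (forall i, exists c, P i c) ->
  exists2 c, 0 <= c & forall i, P i c.
Proof.
move=> Pmono /choice[c cP]; exists (\sum_i `|c i|); first exact: sumr_ge0.
move=> i; apply: Pmono (cP i); rewrite (le_trans (ler_norm _))// (bigD1 i)//= lerDl.
exact: sumr_ge0.
Qed.

Lemma continuous_sum (R : realType) (T : topologicalType) (I : Type) (s : seq I)
    (P : pred I) (f : I -> T -> R) :
  (forall i, continuous (f i)) -> continuous (fun z => \sum_(i <- s | P i) f i z).
Proof.
move=> fc; elim: s => [|i s IH]; first by under eq_fun do rewrite big_nil; exact: cst_continuous.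
under eq_fun do rewrite big_cons.
by case: (P i) => // z; apply: cvgD; [exact: fc|exact: IH].
Qed.

Lemma continuous_mul (R : realType) (T : topologicalType) (f g : T -> R) :
  continuous f -> continuous g -> continuous (fun z => f z * g z).
Proof. by move=> fc gc z; apply: cvgM; [exact: fc|exact: gc]. Qed.

Section CouplingBounds.
Context {R : realType} {m : nat}.

(** Grow the set of indices whose value is within C k of the maximum of v. As
    long as it is proper, some entry of size at least theta joins it to an outside
    index; in the row of that entry all other terms are bounded below in terms of
    C k, so the outside value is within C k.+1 of the maximum. After m steps all
    indices are reached. *)
Lemma coupling_osc_bound (b theta M : R) : 0 <= b -> 0 < theta -> 0 <= M ->
  exists C, forall (A : 'M[R]_m) (v : 'I_m -> R),
    degenerate_mx A -> (forall i j, `|A i j| <= b) ->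
    (forall I : {set 'I_m}, I != finset.set0 -> I \proper finset.setT ->
       exists i j, [/\ i \in I, j \notin I & theta <= `|A i j|]) ->
    (forall i, \sum_j A i j * v j <= M) -> forall i j, v i - v j <= C.
Proof.
move=> b0 th0 M0.
pose C k := iter k (fun c => c + (M + b * m%:R * c) / theta) 0.
have C0 k : 0 <= C k.
  by elim: k => //= k IH; rewrite addr_ge0// divr_ge0 ?(ltW th0)// addr_ge0// !mulr_ge0.
have Cle k : C k <= C k.+1.
  by rewrite /= lerDl divr_ge0 ?(ltW th0)// addr_ge0// !mulr_ge0 ?C0.
exists (C m) => A v [[Aoff _] Asum] Ab Ath AvM i j.
have Av k : \sum_l A k l * v l = \sum_l A k l * (v l - v k).
  under [RHS]eq_bigr do rewrite mulrBr.
  by rewrite sumrB -mulr_suml Asum mul0r subr0.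
pose i0 := [arg max_(k > i) v k]%O.
have i0P k : v k <= v i0 by rewrite /i0; case: arg_maxP => // a _; apply.
pose I k := [set l | v i0 - v l <= C k]%SET.
have IS k : I k \subset I k.+1.
  by apply/fintype.subsetP => l; rewrite !inE => /le_trans; apply.
have card k : (k < #|I k|)%N \/ I k = finset.setT.
  elim: k => [|k [kI|IT]].
  - by left; apply/card_gt0P; exists i0; rewrite inE subrr.
  - have [IT|IT] := eqVneq (I k) finset.setT.
      by right; apply/eqP; rewrite -finset.subTset -IT IS.
    have [||i1 [j1 [i1I j1I Aij]]] := Ath (I k).
    + by rewrite -card_gt0 (leq_trans _ kI).
    + by rewrite finset.properT.
    left; apply: (leq_ltn_trans kI); apply: proper_card; apply/properP; split => //.
    exists j1 => //; rewrite inE.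
    have Ilow l : v l - v i1 <= C k.
      by move: i1I; rewrite inE; apply: le_trans; rewrite lerD2r.
    have ij1 : j1 != i1 by apply: contraNneq j1I => ->.
    have v1 : 0 <= v i1 - v j1.
      rewrite subr_ge0 leNgt; apply: contra j1I; rewrite !inE => /ltW h.
      by move: i1I; rewrite inE; apply: le_trans; rewrite lerD2l lerN2.
    have key : theta * (v i1 - v j1) <= M + b * m%:R * C k.
      have h1 : `|A i1 j1| * (v i1 - v j1) = A i1 j1 * (v j1 - v i1).
        by rewrite ler0_norm ?Aoff// mulNr -mulrN opprB.
      rewrite (@le_trans _ _ (A i1 j1 * (v j1 - v i1)))//.
        by rewrite -h1 ler_wpM2r.
      have := AvM i1; rewrite Av (bigD1 j1)//= => hM.
      rewrite -lerBlDr; apply: le_trans hM; rewrite lerD2l.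
      have -> : - (b * m%:R * C k) = \sum_(l < m) - (b * C k).
        by rewrite sumr_const card_ord -[RHS]mulr_natr; ring.
      rewrite (bigD1 j1)//= -[leRHS]add0r lerD//; first by rewrite oppr_le0 mulr_ge0.
      apply: ler_sum => l lj.
      have [->|li] := eqVneq l i1; first by rewrite subrr mulr0 oppr_le0 mulr_ge0.
      have := Aoff i1 l li; have := Ab i1 l; have := Ilow l; have := C0 k.
      have [vl|vl] := leP 0 (v l - v i1) => c0 h2 h3 h4.
        by move: h3; rewrite ler0_norm// => h3; nra.
      apply: (@le_trans _ _ 0); first by rewrite oppr_le0 mulr_ge0.
      by rewrite mulr_le0// ltW.
    have -> : C k.+1 = C k + (M + b * m%:R * C k) / theta by [].
    have h1 : v i0 - v i1 <= C k by move: i1I; rewrite inE.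
    have h2 : v i1 - v j1 <= (M + b * m%:R * C k) / theta by rewrite ler_pdivlMr// mulrC.
    by move: (lerD h1 h2); rewrite subrKA.
  - by right; apply/eqP; rewrite -finset.subTset -IT IS.
have IT : I m = finset.setT.
  case: (card m) => // h; suff : (m < m)%N by rewrite ltnn.
  by apply: (leq_trans h); rewrite -[leqRHS]card_ord max_card.
have : j \in I m by rewrite IT inE.
by rewrite inE; apply: le_trans; rewrite lerD2r.
Qed.

End CouplingBounds.

(** * Equi-boundedness of subsolutions *)

Section EquiBounds.
Context {R : realType} {N m : nat}.
Local Notation V := 'rV[R]_N.
Variables (H : 'I_m -> V -> V -> R) (B : V -> 'M[R]_m).
Hypotheses (H_ham : forall i, convex_hamiltonian (H i))
  (B_cont : forall i j, torus_continuous (fun x => B x i j))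
  (B_degenerate : forall x, degenerate_mx (B x))
  (B_irreducible : forall x, irreducible_mx (B x)).

Lemma torus_positive (u : V -> R) : torus_continuous u -> (forall x, 0 < u x) ->
  exists2 c, 0 < c & forall x, c <= u x.
Proof.
move=> [uc up] u0.
have [||z _ zP] := EVT_min_rV _ (@ball_compact R N 1) (f := u).
- by exists 0; rewrite /= normr0.
- exact: continuous_subspaceT.
exists (u z) => // x; have [k xk] := cube_reduce x.
by rewrite -(up k x); apply: zP; rewrite inE.
Qed.

Lemma B_bounded : exists2 b, 0 <= b & forall x i j, `|B x i j| <= b.
Proof.
have [//||b b0 bP] := @finite_uniform_bound R ('I_m * 'I_m)%type
  (fun ij c => forall x, `|B x ij.1 ij.2| <= c).
- by move=> ij c c' cc' h x; rewrite (le_trans (h x)).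
- by move=> [i j]; have [c _ cP] := torus_bounded (B_cont i j); exists c.
by exists b => // x i j; exact: (bP (i, j)).
Qed.

(** For each cut the total coupling across it is positive and continuous, hence
    bounded below on the compact torus; there are finitely many cuts. *)
Lemma B_cut : exists2 theta, 0 < theta & forall x (I : {set 'I_m}),
  I != finset.set0 -> I \proper finset.setT ->
  exists i j, [/\ i \in I, j \notin I & theta <= `|B x i j|].
Proof.
have [//||c c0 cP] := @finite_uniform_bound R {set 'I_m}
  (fun I c => I != finset.set0 -> I \proper finset.setT -> forall x,
     exists i j, [/\ i \in I, j \notin I & 1 <= c * `|B x i j|]).
- move=> I c c' cc' h I0 IT x; have [i [j [iI jI hc]]] := h I0 IT x.
  by exists i, j; split => //; rewrite (le_trans hc)// ler_wpM2r.
- move=> I; have [I0|/negP I0] := boolP (I != finset.set0); last by exists 0.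
  have [IT|/negP IT] := boolP (I \proper finset.setT); last by exists 0.
  pose g x := \sum_(i in I) \sum_(j in ~: I) `|B x i j|.
  have gt : torus_continuous g.
    split.
      apply: continuous_sum => i; apply: continuous_sum => j.
      by apply: continuous_normr; exact: (B_cont i j).1.
    move=> k x; apply: eq_bigr => i _; apply: eq_bigr => j _.
    by rewrite ((B_cont i j).2 k x).
  have g0 x : 0 < g x.
    have [i [j [iI jI Bij]]] := B_irreducible x I0 IT.
    rewrite /g (bigD1 i)//= (bigD1 j) ?inE//= -addrA ltr_pwDl ?normr_gt0//.
    by rewrite addr_ge0// ?sumr_ge0// => k _; apply: sumr_ge0.
  have [t t0 tP] := torus_positive gt g0.
  pose c := ((m * m).+1%:R / t : R).
  have c0 : 0 < c by rewrite divr_gt0.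
  exists c => _ _ x; apply: contrapT => h.
  have : c * g x <= (m * m)%:R.
    rewrite mulr_sumr (@le_trans _ _ (\sum_(i in I) m%:R))//.
      apply: ler_sum => i iI; rewrite mulr_sumr (@le_trans _ _ (\sum_(j in ~: I) 1))//.
        apply: ler_sum => j; rewrite inE => jI; rewrite leNgt; apply/negP => h1.
        by apply: h; exists i, j; split => //; exact: ltW.
      by rewrite sumr_const ler_nat -[leqRHS]card_ord max_card.
    rewrite sumr_const -[leLHS]mulr_natr -natrM ler_nat; apply: leq_mul => //.
    by rewrite -[leqRHS]card_ord max_card.
  apply/negP; rewrite -ltNge (@lt_le_trans _ _ (c * t))//.
    by rewrite /c divfK ?gt_eqF// ltr_nat.
  by rewrite ler_wpM2l// ltW.
exists (c + 1)^-1; first by rewrite invr_gt0 ltr_wpDl.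
move=> x I I0 IT; have [i [j [iI jI hc]]] := cP I I0 IT x.
exists i, j; split => //; rewrite -div1r ler_pdivrMr ?ltr_wpDl//.
by rewrite (le_trans hc)// mulrC ler_wpM2l// lerDl.
Qed.

(** For large momenta coercivity makes H nonnegative; the others lie in a compact
    set together with the representatives of x in the unit cube. *)
Lemma H_lower : exists2 M, 0 <= M & forall i x p, - M <= H i x p.
Proof.
have [//||M M0 MP] := @finite_uniform_bound R 'I_m (fun i M => forall x p, - M <= H i x p).
- by move=> i c c' cc' h x p; rewrite (le_trans _ (h x p))// lerN2.
- move=> i; have [Hc Hp _ [al [be [alP _ Hab]]]] := H_ham i.
  have /cvgryPge/(_ 0)[r [_ rP]] := alP.
  pose A : set (V * V) := [set z : V | `|z| <= 1] `*` [set z : V | `|z| <= `|r| + 1].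
  have cA : compact A by apply: compact_setX; exact: ball_compact.
  have A0 : A !=set0 by exists (0, 0); split; rewrite /= normr0// addr_ge0.
  have [|z _ zP] := compact_EVT_min A0 cA (f := fun z : V * V => H i z.1 z.2).
    exact: continuous_subspaceT.
  exists `|H i z.1 z.2| => x p.
  have [pr|pr] := leP (enorm p) (`|r| + 1).
    have [k xk] := cube_reduce x.
    have := zP (x + map_mx intr k, p); rewrite /= (Hp p k x) => h.
    rewrite (@le_trans _ _ (H i z.1 z.2))//; first by rewrite lerNl ler_normr lexx orbT.
    by apply: h; rewrite inE; split => //=; rewrite (le_trans (norm_le_enorm p)).
  have /andP[h _] := Hab x p; rewrite (le_trans _ h)// (@le_trans _ _ 0)// ?oppr_le0//.
  apply: rP; rewrite (lt_trans _ pr)// (le_lt_trans (ler_norm _))// ltrDl//.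
by exists M.
Qed.

Lemma H_coercive (C : R) : exists2 k, 0 <= k & forall i x p, H i x p <= C -> `|p| <= k.
Proof.
have [//||k k0 kP] := @finite_uniform_bound R 'I_m (fun i k => forall x p, H i x p <= C -> `|p| <= k).
- by move=> i c c' cc' h x p /h/le_trans; apply.
- move=> i; have [Hc Hp _ [al [be [alP _ Hab]]]] := H_ham i.
  have /cvgryPge/(_ (C + 1))[r [_ rP]] := alP.
  exists r => x p HC; rewrite (le_trans (norm_le_enorm p))// leNgt; apply/negP => /rP h.
  have /andP[h2 _] := Hab x p.
  by have := le_trans h (le_trans h2 HC); rewrite gerDl ler10.
by exists k => // i x p; exact: kP.
Qed.

Lemma coupling_continuous (u : 'I_m -> V -> R) i : (forall i, continuous (u i)) ->
  continuous (fun x => coupling B u x i).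
Proof.
move=> uc; apply: (@continuous_sum R V _ _ _ (fun j x => B x i j * u j x)) => j.
apply: continuous_mul; [exact: (B_cont i j).1|exact: uc].
Qed.

(** Where the superdifferential of u_i is nonempty, the lower bound of H bounds
    (B u)_i above; such points are dense, so the bound holds everywhere and
    coupling_osc_bound applies. The resulting lower bound of B u turns the
    subsolution inequality into an upper bound of H, hence of the momenta. *)
Lemma subsolution_equi : exists k C, 0 <= k /\
  forall u, subsolution H B 0 u ->
    (forall x i p, superdiff (u i) x p -> `|p| <= k) /\ (forall x i j, u i x - u j x <= C).
Proof.
have [b b0 bP] := B_bounded; have [theta th0 thP] := B_cut; have [M M0 MP] := H_lower.
have [C CP] := @coupling_osc_bound R m _ _ _ b0 th0 M0.
have [k k0 kP] := H_coercive (m%:R * (b * `|C|)).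
exists k, C; split => // u [ut us].
have uc i : continuous (u i) := (ut i).1.
have BM x i : coupling B u x i <= M.
  have [K K0 uK] := torus_bounded (ut i).
  have cc : continuous (fun x => coupling B u x i) by exact: coupling_continuous.
  apply/ler_addgt0Pr => e e0.
  have /cvgrPdist_le /(_ e e0) /nbhs_ballP[d /= d0 dP] := @cc x.
  pose r := d ^+ 2 / (4 * K + 1) / 2.
  have K10 : 0 < 4 * K + 1 by rewrite ltr_wpDl// mulr_ge0.
  have r0 : 0 < r by rewrite !divr_gt0// exprn_gt0.
  have zx : `|prox (u i) r x - x| < d.
    have h := le_trans (sqr_norm_le_sqn _) (prox_near (@uc i) uK x r0).
    rewrite -(@ltr_pXn2r _ 2)// ?nnegrE ?(ltW d0)// (le_lt_trans h)//.
    rewrite /r !mulrA ltr_pdivrMr// ltr_pdivrMr//.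
    have : 0 < d ^+ 2 by rewrite exprn_gt0.
    by nra.
  have /dP : ball x d (prox (u i) r x) by rewrite -ball_normE /= distrC.
  move=> /ler_normlP[_ h1].
  have := us _ i _ (prox_superdiff (@uc i) uK x r0).
  by have := MP i (prox (u i) r x) (r^-1 *: (prox (u i) r x - x)); lra.
have osc x i j : u i x - u j x <= C.
  exact: (CP (B x) (fun l => u l x) (B_degenerate x) (bP x) (thP x) (BM x)).
split => // x i p /us h; apply: (kP i x).
rewrite -lerBrDr sub0r in h; rewrite (le_trans h)//.
have -> : coupling B u x i = \sum_j B x i j * (u j x - u i x).
  under [RHS]eq_bigr do rewrite mulrBr.
  by rewrite sumrB -mulr_suml (B_degenerate x).2 mul0r subr0.
rewrite -sumrN (@le_trans _ _ (\sum_(j < m) b * `|C|))//; last first.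
  by rewrite sumr_const card_ord mulr_natl.
apply: ler_sum => j _; rewrite (le_trans (ler_norm _))// normrN normrM ler_pM//.
rewrite ler_norml lerNl opprB.
by rewrite !(le_trans (osc _ _ _) (ler_norm _)).
Qed.

End EquiBounds.

(** * Limits along ultrafilters and means *)

Lemma cvg_scale (R : realType) (U : normedModType R) (T : Type) (F : set_system T)
    (FF : Filter F) (f : T -> U) (c : R) (l : U) :
  f @ F --> l -> (c *: f t) @[t --> F] --> c *: l.
Proof. by move=> fl; apply: cvgZ => //; exact: cvg_cst. Qed.

Lemma cvg_sum_seq (R : realType) (U : normedModType R) (T I : Type) (F : set_system T)
    (FF : Filter F) (s : seq I) (f : I -> T -> U) (l : I -> U) :
  (forall i, f i @ F --> l i) -> (\sum_(i <- s) f i t) @[t --> F] --> \sum_(i <- s) l i.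
Proof.
move=> fl; elim: s => [|i s IH].
  by rewrite big_nil; under eq_fun do rewrite big_nil; exact: cvg_cst.
by rewrite big_cons; under eq_fun do rewrite big_cons; apply: cvgD.
Qed.

Lemma cvg_le_inv_natS (R : realType) (U : normedModType R) (f : nat -> U) (l : U) :
  (forall n, `|f n - l| <= n.+1%:R^-1) -> f @ \oo --> l.
Proof.
move=> fl; apply/cvgrPdist_le => e e0; have := @cvg_harmonic R => /cvgrPdist_le /(_ e e0).
apply: filterS => n; rewrite sub0r normrN => hn; rewrite distrC (le_trans (fl n))//.
exact: le_trans (ler_norm _) hn.
Qed.

Lemma cvg_joint (R : realType) (N : nat) (F : 'rV[R]_N -> 'rV[R]_N -> R) (G : set_system nat)
    (GP : ProperFilter G) (z p : nat -> 'rV[R]_N) x P :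
  continuous (fun w : 'rV[R]_N * 'rV[R]_N => F w.1 w.2) ->
  z @ G --> x -> p @ G --> P -> F (z n) (p n) @[n --> G] --> F x P.
Proof.
move=> Fc zx pP; have GF : Filter G by typeclasses eauto.
have h := cvg_pair (FF := GF) (FG := nbhs_filter x) (FH := nbhs_filter P) zx pP.
exact: (cvg_comp _ _ h (@Fc (x, P))).
Qed.

Section UltraLimit.
Context {R : realType} {N : nat}.
Local Notation V := 'rV[R]_N.

(** Limits along one ultrafilter exist for all the sequences of a family at once,
    without extracting subsequences successively. *)
Lemma ultra_bounded_cvg (T : Type) (G : set_system T) (p : T -> V) (k : R) :
  UltraFilter G -> (forall t, `|p t| <= k) -> exists l : V, p @ G --> l.
Proof.
move=> GU pk.
have GP : ProperFilter G by exact: ultra_proper.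
have pA : (p @ G) [set q : V | `|q| <= k] by apply: (@filterE _ G) => t; exact: pk.
have [l [_ lcl]] := @ball_compact R N k (p @ G) _ pA.
exists l => U Ul; rewrite /fmap /=.
have [//|GC] := in_ultra_setVsetC (p @^-1` U) GU.
have [z [/= zU zC]] := lcl (~` U) U GC Ul.
by [].
Qed.

End UltraLimit.

Section Averages.
Context {R : realType} {I : eqType}.
Implicit Types (s : seq I) (f g : I -> R).

Definition avg s f : R := (size s)%:R^-1 * \sum_(u <- s) f u.

Lemma avg_le s f g : {in s, forall u, f u <= g u} -> avg s f <= avg s g.
Proof.
move=> fg; rewrite /avg ler_wpM2l ?invr_ge0//.
by rewrite big_seq [leRHS]big_seq; exact: ler_sum.
Qed.

Lemma avgD s f g : avg s (fun u => f u + g u) = avg s f + avg s g.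
Proof. by rewrite /avg big_split mulrDr. Qed.

Lemma avgB s f g : avg s (fun u => f u - g u) = avg s f - avg s g.
Proof. by rewrite /avg sumrB mulrBr. Qed.

Lemma avg_const s (c : R) : (0 < size s)%N -> avg s (fun=> c) = c.
Proof.
move=> s0; rewrite /avg big_const_seq count_predT iter_addr_0 -(mulr_natl c).
by rewrite mulrA mulVf ?mul1r// pnatr_eq0 -lt0n.
Qed.

Definition avgV {N} s (P : I -> 'rV[R]_N) : 'rV[R]_N := (size s)%:R^-1 *: \sum_(u <- s) P u.

Lemma dot_avgV N s (P : I -> 'rV[R]_N) h : dot (avgV s P) h = avg s (fun u => dot (P u) h).
Proof.
rewrite /avgV dotZl /avg; congr (_ * _).
elim: s => [|u s IH]; first by rewrite !big_nil dotC dot0r.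
by rewrite !big_cons dotDl IH.
Qed.

Lemma strictly_convex_le N (F : 'rV[R]_N -> R) p q (t c : R) : strictly_convex F ->
  0 < t < 1 -> F p <= c -> F q <= c -> F (t *: p + (1 - t) *: q) <= c.
Proof.
move=> Fs /andP[t0 t1] Fp Fq; have [->|pq] := eqVneq p q.
  by rewrite -scalerDl addrC subrK scale1r.
have t01 : 0 < t < 1 by rewrite t0.
apply: (le_trans (ltW (Fs p q t pq t01))).
by nra.
Qed.

Lemma avgV_cons N u s (P : I -> 'rV[R]_N) : (0 < size s)%N ->
  avgV (u :: s) P = (size s).+1%:R^-1 *: P u + (1 - (size s).+1%:R^-1) *: avgV s P.
Proof.
move=> s0; rewrite /avgV /= big_cons scalerDr; congr (_ + _).
rewrite scalerA; congr (_ *: _); rewrite -natr1.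
have h1 : (size s)%:R != 0 :> R by rewrite pnatr_eq0 -lt0n.
have h2 : (size s)%:R + 1 != 0 :> R by rewrite natr1 pnatr_eq0.
by field; rewrite h1 h2.
Qed.

Lemma inv_size_itv s : (0 < size s)%N -> 0 < ((size s).+1%:R^-1 : R) < 1.
Proof. by move=> s0; rewrite invr_gt0 ltr0Sn/= invf_lt1// ltr1n. Qed.

Lemma strictly_convex_avg N (F : 'rV[R]_N -> R) (c : R) s (P : I -> 'rV[R]_N) :
  strictly_convex F -> (0 < size s)%N -> {in s, forall u, F (P u) <= c} -> F (avgV s P) <= c.
Proof.
move=> Fs; elim: s => // u s IH _ sc.
have Pu : F (P u) <= c by apply: sc; rewrite mem_head.
case: (posnP (size s)) => s0.
  by rewrite /avgV (size0nil s0) big_cons big_nil addr0 invr1 scale1r.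
rewrite avgV_cons//; apply: strictly_convex_le => //; first exact: inv_size_itv.
by apply: IH => // w ws; apply: sc; rewrite in_cons ws orbT.
Qed.

Lemma avgV_perm N s1 s2 (P : I -> 'rV[R]_N) : perm_eq s1 s2 -> avgV s1 P = avgV s2 P.
Proof. by move=> s12; rewrite /avgV (perm_size s12) (perm_big _ s12). Qed.

(** If P u differed from the mean of the other points, which lies in the same
    sublevel, F would be less than c at the mean of all. *)
Lemma strictly_convex_avg_eq N (F : 'rV[R]_N -> R) (c : R) s (P : I -> 'rV[R]_N) :
  strictly_convex F -> {in s, forall u, F (P u) <= c} -> c <= F (avgV s P) ->
  {in s, forall u, P u = avgV s P}.
Proof.
move=> Fs sc cs u us.
rewrite (avgV_perm P (perm_to_rem us)) in cs *.
set s' := rem u s in cs *.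
have [s0|s0] := posnP (size s').
  by rewrite /avgV (size0nil s0) big_cons big_nil addr0 invr1 scale1r.
have s'c : F (avgV s' P) <= c.
  by apply: strictly_convex_avg => // w /mem_rem; exact: sc.
rewrite avgV_cons// in cs *.
have [<-|pq] := eqVneq (P u) (avgV s' P); first by rewrite -scalerDl addrC subrK scale1r.
have t01 := inv_size_itv s0.
have := le_lt_trans cs (Fs _ _ _ pq t01).
have /andP[t0 t1] := t01; have h2 := sc u us.
set t := _^-1 in t0 t1 *; set A := F _ in h2 *; set B := F _ in s'c *.
by move=> h3; exfalso; nra.
Qed.

End Averages.

(** * Doubling of variables *)

Section Doubling.
Context {R : realType} {N : nat} {I : eqType}.
Local Notation V := 'rV[R]_N.
Variables (s : seq I) (w : I -> V -> R) (Phi : V -> R) (y : V) (M k : R).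
Hypotheses (s_gt0 : (0 < size s)%N)
  (wc : forall u, continuous (w u)) (wM : forall u x, `|w u x| <= M)
  (wk : forall u z p, superdiff (w u) z p -> `|p| <= k)
  (Phic : continuous Phi) (PhiM : forall x, `|Phi x| <= M)
  (ymax : forall u x, w u x - Phi x <= w u y - Phi y).

(** After maximizing over one variable z_u for each function w u, doubling of
    variables between the mean of the w u and Phi is a maximization in x only. *)
Definition penalized (e : R) (x : V) : R :=
  avg s (fun u => supconv (w u) e x) - Phi x - quad 0 2^-1 y x.

Lemma penalized_max e : 0 < e -> exists x, forall z, penalized e z <= penalized e x.
Proof.
move=> e0; have M0 : 0 <= M by exact: le_trans (PhiM 0).
have low x : - M <= avg s (fun u => supconv (w u) e x).
  rewrite -(avg_const (- M) s_gt0); apply: avg_le => u _.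
  rewrite (le_trans _ (supconv_ge (@wc u) (wM u) x e0))//.
  by have /ler_normlP[] := wM u x; lra.
have upp x : avg s (fun u => supconv (w u) e x) <= M.
  rewrite -(avg_const M s_gt0); apply: avg_le => u _.
  by rewrite (le_trans (supconv_le (w u) x e0))// (le_trans (ler_norm _)).
(* Beyond this radius the penalty exceeds 4 * M, which bounds the oscillation of
   the remaining terms. *)
apply: (@max_coercive _ _ _ y (1 + 8 * M)).
  have c1 : continuous (fun x => \sum_(u <- s) supconv (w u) e x).
    apply: continuous_sum => u.
    exact: lipV_continuous (supconv_lipschitz (@wc u) (wM u) (wk (u := u)) e0).
  have c2 : continuous (fun x => avg s (fun u => supconv (w u) e x)).
    have c0 : continuous (fun _ : V => (size s)%:R^-1 : R) by exact: cst_continuous.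
    exact: (continuous_mul c0 c1).
  have c3 := continuous_diff c2 Phic.
  exact: (continuous_diff c3 (@quad_continuous _ _ 0 2^-1 y)).
move=> z zy; rewrite /penalized quad_center quad0E.
have h1 : 8 * M <= sqn (z - y) by rewrite (le_trans _ (sqr_norm_le_sqn _))//; nra.
have := low y; have := upp z; have /ler_normlP[] := PhiM z; have /ler_normlP[] := PhiM y.
by lra.
Qed.

(** Compare the values at x and y: replacing supconv by w u costs O(e) by the
    Lipschitz bound, and y maximizes w u - Phi. *)
Lemma doubling_near e x : 0 < e -> (forall z, penalized e z <= penalized e x) ->
  sqn (x - y) <= 2 * (N%:R * k * (k * e)).
Proof.
move=> e0 xmax.
have k0 : 0 <= k.
  have [u _] : exists u, u \in s by case: s s_gt0 => // u s' _; exists u; rewrite mem_head.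
  exact: (superdiff_bound_ge0 (@wc u) (wM u) (wk (u := u))).
have := xmax y; rewrite /penalized quad_center quad0E subr0.
have h1 : avg s (fun u => w u y) <= avg s (fun u => supconv (w u) e y).
  by apply: avg_le => u _; exact: (supconv_ge (@wc u) (wM u) y e0).
have h2 : avg s (fun u => supconv (w u) e x) <= avg s (fun u => w u x + N%:R * k * (k * e)).
  apply: avg_le => u _; rewrite (le_trans (supconv_le (w u) x e0))// -lerBlDl.
  rewrite (le_trans (ler_norm _))//.
  rewrite (le_trans (superdiff_bound_lipschitz (@wc u) (wM u) (wk (u := u)) _ _))//.
  by rewrite ler_wpM2l ?mulr_ge0// (prox_le (@wc u) (wM u) (wk (u := u)) x e0).
have h3 : avg s (fun u => w u x - Phi x) <= avg s (fun u => w u y - Phi y).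
  by apply: avg_le => u _; exact: ymax.
rewrite avgD avg_const// in h2.
rewrite (avgB s (fun u => w u x) (fun=> Phi x)) (avgB s (fun u => w u y) (fun=> Phi y)) !avg_const// in h3.
by move: h1 h2 h3; lra.
Qed.

(** Freezing the maximizers of the sup-convolutions gives a smooth function below
    Phi, up to a constant, that touches it at x. *)
Lemma doubling_subdiff e x : 0 < e -> (forall z, penalized e z <= penalized e x) ->
  subdiff Phi x (avgV s (fun u => e^-1 *: (prox (w u) e x - x)) - (x - y)).
Proof.
move=> e0 xmax; pose a := (2 * e)^-1.
apply: (@subdiff_quad _ _ _ _ _ (- (a + 2^-1))).
near=> x'.
pose S1 := avg s (fun u => supconv (w u) e x).
pose S2 := avg s (fun u => penal (w u) e x' (prox (w u) e x)).
have h : S2 - Phi x' - quad 0 2^-1 y x' <= S1 - Phi x - quad 0 2^-1 y x.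
  rewrite (le_trans _ (xmax x'))// /penalized !lerB//; apply: avg_le => u _.
  exact: (proxP (@wc u) (wM u)).
pose d := x' - x.
have E u : supconv (w u) e x - penal (w u) e x' (prox (w u) e x) =
   - dot (e^-1 *: (prox (w u) e x - x)) d + a * sqn d.
  rewrite /supconv /penal !quad0E -/a.
  rewrite (_ : prox (w u) e x - x' = (prox (w u) e x - x) - d); last first.
    by rewrite /d opprB subrKA.
  rewrite (sqnB (prox (w u) e x - x) d) dotZl /a; field; rewrite gt_eqF//.
have SE : S1 - S2 = - dot (avgV s (fun u => e^-1 *: (prox (w u) e x - x))) d + a * sqn d.
  rewrite /S1 /S2 -avgB dot_avgV -[in RHS](avg_const (a * sqn d) s_gt0).
  rewrite -[- avg _ _]sub0r -[in RHS](avg_const 0 s_gt0) -avgB -avgD.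
  by congr avg; apply/funext => u; rewrite E sub0r.
move: h; rewrite !quad0E (_ : x' - y = (x - y) + d); last by rewrite /d [RHS]addrC subrKA.
rewrite (sqnD (x - y) d) /quad -/d (dotBl d (avgV _ _)) => h.
by move: SE h; lra.
Unshelve. all: by end_near. Qed.

Lemma doubling : exists (x : nat -> V) (z p : I -> nat -> V) (G : set_system nat) (P : I -> V),
  [/\ ProperFilter G, x @ G --> y, forall u, z u @ G --> y, forall u, p u @ G --> P u &
   (forall u n, superdiff (w u) (z u n) (p u n)) /\
   forall n, subdiff Phi (x n) (avgV s (p ^~ n) - (x n - y))].
Proof.
pose e (n : nat) : R := n.+1%:R^-1.
have e0 n : 0 < e n by rewrite invr_gt0.
have /choice[x xP] : forall n, exists x, forall z, penalized (e n) z <= penalized (e n) x.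
  by move=> n; exact: penalized_max.
pose z u n := prox (w u) (e n) (x n).
pose p u n := (e n)^-1 *: (z u n - x n).
have zp u n : superdiff (w u) (z u n) (p u n) by exact: (prox_superdiff (@wc u) (wM u)).
have [G [GU Goo]] := @ultraFilterLemma nat \oo _.
have GP : ProperFilter G by exact: ultra_proper.
have /choice[P pP] : forall u, exists l : V, p u @ G --> l.
  by move=> u; apply: (ultra_bounded_cvg GU) => n; exact: (wk (zp u n)).
have eG : e n @[n --> G] --> 0 by exact: cvg_inv_natS.
have k0 : 0 <= k.
  have [u _] : exists u, u \in s by case: s s_gt0 => // u s' _; exists u; rewrite mem_head.
  exact: (superdiff_bound_ge0 (@wc u) (wM u) (wk (u := u))).
pose K := 2 * (N%:R * k * k) + 1.
have K0 : 0 < K by rewrite ltr_wpDl// !mulr_ge0.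
have xn n : `|x n - y| ^+ 2 <= K * e n.
  rewrite (le_trans (sqr_norm_le_sqn _))// (le_trans (doubling_near (e0 n) (xP n)))//.
  by have := e0 n; rewrite /K; nra.
have xy : x @ G --> y.
  apply/cvgrPdist_lt => r r0.
  have rK : 0 < r ^+ 2 / K by rewrite divr_gt0// exprn_gt0.
  move/cvgrPdist_lt : eG => /(_ _ rK).
  apply: filterS => n; rewrite sub0r normrN (gtr0_norm (e0 n)) ltr_pdivlMr// => h.
  rewrite distrC -(@ltr_pXn2r _ 2)// ?nnegrE ?(ltW r0)//.
  by rewrite (le_lt_trans (xn n))// mulrC.
have zy u : z u @ G --> y.
  have -> : z u = (fun n => x n + (e n) *: p u n).
    by apply/funext => n; rewrite /p scalerA divff ?gt_eqF// scale1r addrC subrK.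
  rewrite -[y]addr0 -(scale0r (P u)); apply: cvgD => //; apply: cvgZ => //; exact: pP.
exists x, z, p, G, P; split => //; split => // n.
exact: doubling_subdiff.
Qed.

End Doubling.

(** * Exposed points of strictly convex sublevel sets *)

Lemma dot_continuous (R : realType) (N : nat) (q : 'rV[R]_N) : continuous (dot q : 'rV[R]_N -> R).
Proof. by apply: (@lipV_continuous _ _ (N%:R * `|q|)) => a b; exact: dot_lipschitz. Qed.

Lemma cvg_coord (R : realType) (N : nat) (T : Type) (G : set_system T) (GF : Filter G)
    (p : T -> 'rV[R]_N) (P : 'rV[R]_N) (k : 'I_N) : p @ G --> P -> p t 0 k @[t --> G] --> P 0 k.
Proof.
move=> pP.
have -> : (fun t => p t 0 k) = dot (delta_mx 0 k) \o p.
  by apply/funext => t /=; rewrite dotC dot_delta.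
rewrite -(dot_delta P) dotC.
exact: (cvg_comp _ _ pP (@dot_continuous R N (delta_mx 0 k) P)).
Qed.

Lemma cvg_dot (R : realType) (N : nat) (T : Type) (G : set_system T) (GF : Filter G)
    (p h : T -> 'rV[R]_N) (P Q : 'rV[R]_N) :
  p @ G --> P -> h @ G --> Q -> dot (p t) (h t) @[t --> G] --> dot P Q.
Proof.
move=> pP hQ; rewrite /dot; apply: (@cvg_sum_seq R R^o) => k.
by apply: cvgM; exact: cvg_coord.
Qed.

Section ExposedPoint.
Context {R : realType} {N : nat}.
Local Notation V := 'rV[R]_N.
Variables (F : V -> R) (c : R).
Hypotheses (Fc : continuous F) (Fs : strictly_convex F)
  (Kcompact : compact [set p | F p <= c]).

(** First variation of the squared distance along the segment from a to p. *)
Lemma nearest_point (r p0 : V) : F p0 <= c ->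
  exists2 a, F a <= c /\ sqn (a - r) <= sqn (p0 - r) &
    forall p, F p <= c -> dot (r - a) (p - a) <= 0.
Proof.
move=> Fp0.
have [||a] := EVT_min_rV _ Kcompact (f := quad 0 1 r).
- by exists p0.
- by apply: continuous_subspaceT; exact: quad_continuous.
rewrite inE /= => Fa aP.
have {}aP p : F p <= c -> sqn (a - r) <= sqn (p - r).
  by move=> Fp; have := aP p; rewrite !quad0E !mul1r inE; exact.
exists a; first by split=> //; exact: aP.
move=> p Fp; rewrite leNgt; apply/negP => d0.
set D := dot _ _ in d0.
have s0 := sqn_ge0 (p - a).
pose t := D / (sqn (p - a) + D + D).
have den0 : 0 < sqn (p - a) + D + D by lra.
have t01 : 0 < t < 1.
  by rewrite divr_gt0//= ltr_pdivrMr// mul1r; lra.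
have := aP _ (strictly_convex_le Fs t01 Fp Fa).
have -> : t *: p + (1 - t) *: a - r = (a - r) + t *: (p - a).
  by apply/rowP => i; rewrite !mxE; ring.
rewrite (sqnD (a - r) (t *: (p - a))) dotZr sqnZ -(opprB r a) dotNl -/D => h.
have /andP[t0 t1] := t01.
have : t * (sqn (p - a) + D + D) = D by rewrite /t divfK// gt_eqF.
by move: h; rewrite !opprB; nra.
Qed.

(** If p minimizes F, strict convexity makes it the only point of the sublevel
    and the zero vector is suitable. Otherwise p is the limit of points r n outside
    the sublevel; the unit vectors pointing from the projections of r n to r n
    accumulate at a normal q at p. A second point with the same value of dot q would put their
    midpoint in the interior of the sublevel, where dot q cannot be maximal. *)
Lemma exposed_normal p : F p = c ->
  exists q, forall p', F p' <= c -> dot q p <= dot q p' -> p' = p.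
Proof.
move=> Fp.
have [pmin|] := pselect (forall p', c <= F p').
  exists 0 => p' Fp' _; apply/eqP/negPn/negP => pp'.
  have h12 : 0 < (2^-1 : R) < 1 by rewrite invr_gt0 ltr0n/= invf_lt1// ltr1n.
  have := Fs pp' h12; have := pmin (2^-1 *: p' + (1 - 2^-1) *: p); rewrite Fp.
  by lra.
move=> /existsNP[p0 /negP]; rewrite -ltNge => Fp0.
have Fple : F p <= c by rewrite Fp.
pose e (n : nat) : R := n.+1%:R^-1.
have e0 n : 0 < e n by rewrite invr_gt0.
pose r n := p + e n *: (p - p0).
(* p lies strictly between p0 and r n; if F (r n) <= c, then F p < c. *)
have Fr n : c < F (r n).
  rewrite ltNge; apply/negP => h.
  pose t := (1 + e n)^-1.
  have t01 : 0 < t < 1 by rewrite invr_gt0 addr_gt0//= invf_lt1 ?addr_gt0// ltrDl.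
  have pE : p = t *: r n + (1 - t) *: p0.
    have h1 : 1 + e n != 0 by rewrite gt_eqF// addr_gt0.
    by apply/rowP => i; rewrite !mxE /t; field.
  have rp0 : r n != p0.
    by apply/eqP => rp; move: Fp0; rewrite -rp ltNge => /negP; apply; rewrite -Fp {1}pE rp -scalerDl addrC subrK scale1r lexx.
  have /andP[t0 t1] := t01; have := Fs rp0 t01; rewrite -pE Fp => h3.
  by move: h h3 Fp0; set A := F _; set B := F _ => *; nra.
have /choice[a aP] : forall n, exists a, [/\ F a <= c, sqn (a - r n) <= sqn (p - r n) &
    forall p', F p' <= c -> dot (r n - a) (p' - a) <= 0].
  by move=> n; have [a [h1 h2] h3] := nearest_point (r n) Fple; exists a.
have ra n : 0 < `|r n - a n|.
  rewrite normr_gt0 subr_eq0; apply/eqP => rE; have [] := aP n; rewrite -rE => h _ _.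
  by have := Fr n; rewrite ltNge h.
pose q n := `|r n - a n|^-1 *: (r n - a n).
have q1 n : `|q n| = 1 by rewrite normrZ gtr0_norm ?invr_gt0// mulVf// gt_eqF.
have [G [GU Goo]] := @ultraFilterLemma nat \oo _.
have GP : ProperFilter G by exact: ultra_proper.
have [Q qQ] : exists l : V, q @ G --> l by apply: (ultra_bounded_cvg GU) => n; rewrite q1.
have eG : e n @[n --> G] --> (0 : R) by exact: cvg_inv_natS.
have Q1 : `|Q| = 1.
  have h1 : `|q n| @[n --> G] --> `|Q| by exact: cvg_norm.
  have E : (fun n => `|q n|) = (fun=> 1) by apply/funext => n; rewrite q1.
  rewrite E in h1; exact: (norm_cvg_unique h1 (cvg_cst _)).
have rp : r @ G --> p.
  rewrite -[p in X in _ --> X]addr0 -(scale0r (p - p0)); apply: cvgD; first exact: cvg_cst.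
  by apply: cvgZ => //; exact: cvg_cst.
have ap : a @ G --> p.
  have h (n : nat) : `|a n - r n| ^+ 2 <= N%:R * (`|p - p0| ^+ 2) * e n ^+ 2.
    have [_ h2 _] := aP n; rewrite (le_trans (sqr_norm_le_sqn _))// (le_trans h2)//.
    rewrite /r opprD addrA subrr sub0r sqnN sqnZ mulrC ler_wpM2r ?sqr_ge0//.
    exact: sqn_le_sqr_norm.
  have -> : a = (fun n => r n + (a n - r n)) by apply/funext => n; rewrite addrC subrK.
  rewrite -[p in X in _ --> X]addr0; apply: cvgD => //.
  pose K := N%:R * `|p - p0| ^+ 2 + 1.
  have K0 : 0 < K by rewrite ltr_wpDl// mulr_ge0// sqr_ge0.
  apply/cvgrPdist_lt => d d0.
  have dK : 0 < d / K by rewrite divr_gt0.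
  move/cvgrPdist_lt : eG => /(_ _ dK); apply: filterS => n.
  rewrite !sub0r !normrN (gtr0_norm (e0 n)) ltr_pdivlMr// => h4.
  rewrite -(@ltr_pXn2r _ 2)// ?nnegrE ?(ltW d0)// (le_lt_trans (h n))//.
  have h5 : (e n * K) ^+ 2 < d ^+ 2.
    by rewrite ltr_pXn2r// ?nnegrE ?(ltW d0)// mulr_ge0 ?ltW.
  apply: le_lt_trans h5; rewrite exprMn [leRHS]mulrC ler_wpM2r ?sqr_ge0//.
  have : 0 <= N%:R * `|p - p0| ^+ 2 by rewrite mulr_ge0// sqr_ge0.
  by rewrite /K; nra.
have Qmax p' : F p' <= c -> dot Q p' <= dot Q p.
  move=> Fp'; rewrite -subr_le0 -dotBr.
  have h1 : dot (q n) (p' - a n) @[n --> G] --> dot Q (p' - p).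
    by apply: cvg_dot => //; apply: cvgB => //; exact: cvg_cst.
  apply: (ler_cvg_to h1 (cvg_cst 0)).
  apply: nearW => n; rewrite /q dotZl; have [_ _ h] := aP n.
  by rewrite mulr_ge0_le0// ?invr_ge0// h.
exists Q => p' Fp' pp'; apply/eqP/negPn/negP => np.
have h12 : 0 < (2^-1 : R) < 1 by rewrite invr_gt0 ltr0n/= invf_lt1// ltr1n.
have := Fs np h12; rewrite Fp; set mid := _ + _ => Fm.
have {}Fm : F mid < c by lra.
have : continuous (fun t : R => F (mid + t *: Q)).
  move=> t0; have h : (mid + t *: Q) @[t --> t0] --> mid + t0 *: Q.
    by apply: cvgD; [exact: cvg_cst|apply: cvgZ; [exact: cvg_id|exact: cvg_cst]].
  exact: (cvg_comp _ _ h (@Fc _)).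
move=> /(_ 0)/cvgrPdist_lt; rewrite scale0r addr0.
have Fm' : 0 < c - F mid by rewrite subr_gt0.
move=> /(_ _ Fm') /nbhs_ballP[d /= d0 dP].
have /dP : ball (0 : R) d (d / 2).
  by rewrite -ball_normE /= sub0r normrN gtr0_norm ?divr_gt0// ltr_pdivrMr// ltr_pMr// ltr1n.
move=> /= /ltr_normlP[h1 h2].
have : F (mid + (d / 2) *: Q) <= c by lra.
move=> /Qmax; rewrite dotDr dotZr /mid dotDr !dotZr.
have Q0 : 0 < dot Q Q.
  by rewrite (lt_le_trans _ (sqr_norm_le_sqn Q))// Q1 expr1n.
by nra.
Qed.
End ExposedPoint.

(** * From superdifferentials to reachable gradients *)

Section Reachable.
Context {R : realType} {N : nat}.
Local Notation V := 'rV[R]_N.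
Variables (u c : V -> R) (F : V -> V -> R) (L k : R).
Hypotheses (L_gt0 : 0 < L) (uL : lipV L u) (cc : continuous c)
  (Fc : continuous (fun z : V * V => F z.1 z.2))
  (uk : forall x p, superdiff u x p -> `|p| <= k)
  (usub : forall x p, superdiff u x p -> F x p + c x <= 0).

(** Subtracting a steep enough paraboloid from u - <P, .> creates an interior
    maximum near x. *)
Lemma frechet_near_superdiff x P : frechet u x P -> forall e, 0 < e ->
  exists z p, [/\ `|z - x| <= e, `|p - P| <= e & superdiff u z p].
Proof.
move=> uP e e0.
have e4 : 0 < e / 4 by rewrite divr_gt0.
have [d d0 dP] := uP _ e4.
pose r := Num.min d e.
have r0 : 0 < r by rewrite lt_min d0.
(* At distance r the penalty a * r ^+ 2 = e / 2 * r beats the error e / 4 * r. *)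
pose a := e / (2 * r).
have a0 : 0 < a by rewrite divr_gt0// mulr_gt0.
pose f z := u z - quad P a x z.
pose A := [set z : V | `|z - x| <= r].
have cA : compact A by exact: closed_ball_compact.
have Ax : A x by rewrite /A /= subrr normr0 ltW.
have [|z] := EVT_max_rV (ex_intro _ x Ax) cA (f := f).
  apply: continuous_subspaceT; apply: continuous_diff; first exact: lipV_continuous uL.
  exact: quad_continuous.
rewrite inE /A /= => zr zmax.
have zltr : `|z - x| < r.
  rewrite lt_neqAle zr andbT; apply/eqP => zE.
  have := zmax x; rewrite inE /= => /(_ Ax); rewrite /f quad_center subr0 /quad.
  have := dP (z - x); rewrite zE (addrC x) subrK => /(_ _)/ler_normlP[|_].
    by rewrite /r ge_min lexx.
  have := sqr_norm_le_sqn (z - x); rewrite zE => h1 h2 h3.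
  have h4 : a * r ^+ 2 <= a * sqn (z - x) by rewrite ler_wpM2l// ltW.
  have h5 : a * r ^+ 2 = e / 2 * r by rewrite /a; field; rewrite gt_eqF.
  have : 0 < e * r by rewrite mulr_gt0.
  by lra.
exists z, (P + (2 * a) *: (z - x)); split.
- by rewrite (le_trans zr)// /r ge_min lexx orbT.
- have a20 : 0 < 2 * a by rewrite pmulr_rgt0.
  rewrite addrAC subrr add0r normrZ (gtr0_norm a20).
  rewrite (@le_trans _ _ (2 * a * r))//; first by rewrite ler_wpM2l// ltW.
  by rewrite /a le_eqVlt; apply/orP; left; apply/eqP; field; rewrite gt_eqF.
- apply: (@superdiff_quad _ _ _ _ _ a).
  apply/nbhs_ballP; exists (r - `|z - x|); first by rewrite /= subr_gt0.
  move=> z'; rewrite -ball_normE /= ltrBrDr => zz'.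
  have : f z' <= f z.
    apply: zmax; rewrite inE /=; apply: le_trans (ltW zz').
    by rewrite (le_trans (ler_distD z _ _))// distrC.
  rewrite /f /quad.
  rewrite (_ : z' - x = (z - x) + (z' - z)); last by rewrite [RHS]addrC subrKA.
  rewrite (sqnD (z - x) (z' - z)) (dotDr P (z - x) (z' - z)) (dotDl (z' - z) P) dotZl.
  by lra.
Qed.

Lemma cvg_pair_le (G : set_system nat) (GP : ProperFilter G) (z p : nat -> V) x P :
  z @ G --> x -> p @ G --> P -> (forall t, F (z t) (p t) + c (z t) <= 0) -> F x P + c x <= 0.
Proof.
move=> zx pP h.
have h2 : F (z t) (p t) @[t --> G] --> F x P by exact: cvg_joint.
have h3 : c (z t) @[t --> G] --> c x := cvg_comp _ _ zx (@cc x).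
by apply: (ler_cvg_to (cvgD h2 h3) (cvg_cst 0)); exact: nearW.
Qed.

Lemma frechet_subsolution x P : frechet u x P -> F x P + c x <= 0 /\ `|P| <= k + 1.
Proof.
move=> uP; split; last first.
  have [z [p [_ pP zp]]] := frechet_near_superdiff uP ltr01.
  rewrite -(subrK p P) addrC (le_trans (ler_normD _ _))// lerD//; first exact: uk zp.
  by rewrite distrC.
have h (n : nat) : exists zp : V * V,
    [/\ `|zp.1 - x| <= n.+1%:R^-1, `|zp.2 - P| <= n.+1%:R^-1 & superdiff u zp.1 zp.2].
  have [z [p h]] := frechet_near_superdiff uP (e := n.+1%:R^-1) ltac:(by rewrite invr_gt0).
  by exists (z, p).
have [zp zpP] := choice h.
apply: (@cvg_pair_le \oo _ (fun n => (zp n).1) (fun n => (zp n).2)).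
- by apply: cvg_le_inv_natS => n; have [] := zpP n.
- by apply: cvg_le_inv_natS => n; have [] := zpP n.
- by move=> n; apply: usub; have [] := zpP n.
Qed.

Definition limit_superdiff (y p : V) : Prop :=
  forall e, 0 < e -> exists x p', [/\ `|x - y| < e, `|p' - p| < e & superdiff u x p'].

(** A superdifferential p' at x bounds u (x - t *: q) from above, so u gains at
    least about t * dot q p' on the segment from x - t *: q to x; the directional
    form of Rademacher's theorem applies to this segment. *)
Lemma frechet_along y p q : limit_superdiff y p -> forall e, 0 < e ->
  exists z g, [/\ `|z - y| < e, frechet u z g & dot q p - e <= dot q g].
Proof.
move=> yp e e0.
pose Q := `|q| + 1. have Q0 : 0 < Q by rewrite ltr_wpDl.
pose M := 4 * (N%:R + 1) * Q. have M0 : 0 < M by rewrite !mulr_gt0// ltr_wpDl.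
pose e1 := Num.min (e / M) (e / 4).
have e10 : 0 < e1 by rewrite lt_min !divr_gt0.
have [x [p' [xy pp' xp']]] := yp _ e10.
have e20 : 0 < e / (4 * Q) by rewrite divr_gt0// mulr_gt0.
have [d d0 dP] := superdiff_le xp' e20.
pose d' := Num.min d (e / 4). have d'0 : 0 < d' by rewrite lt_min d0 divr_gt0.
pose t := d' / Q. have t0 : 0 < t by rewrite divr_gt0.
have tq : t * `|q| <= d'.
  by rewrite /t mulrAC ler_pdivrMr// ler_wpM2l ?(ltW d'0)// lerDl.
have nq : `|- (t *: q)| = t * `|q| by rewrite normrN normrZ gtr0_norm.
have h : u (x - t *: q) <= u x - t * dot p' q + e / (4 * Q) * (t * `|q|).
  have := dP (- (t *: q)); rewrite nq dotNr dotZr; apply.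
  by rewrite (le_trans tq)// /d' ge_min lexx.
have h1 : `|dot (p' - p) q| <= e / 4.
  rewrite (le_trans (normr_dot _ _))//.
  have pe : `|p' - p| <= e / M by rewrite (le_trans (ltW pp'))// /e1 ge_min lexx.
  rewrite (@le_trans _ _ ((N%:R + 1) * (e / M) * Q))//.
    rewrite ler_pM// ?mulr_ge0//; last by rewrite lerDl.
    by rewrite ler_pM// lerDl.
  have N0 : 0 < N%:R + 1 :> R by rewrite ltr_wpDl.
  by rewrite le_eqVlt; apply/orP; left; apply/eqP; rewrite /M; field; rewrite !gt_eqF.
have h2 : e / (4 * Q) * (t * `|q|) <= t * (e / 4).
  rewrite (@le_trans _ _ (e / (4 * Q) * (t * Q)))//.
    by rewrite ler_wpM2l ?(ltW e20)// ler_wpM2l ?(ltW t0)// lerDl.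
  by rewrite le_eqVlt; apply/orP; left; apply/eqP; field; rewrite gt_eqF.
have h3 : (dot q p - e) * t < u ((x - t *: q) + t *: q) - u (x - t *: q).
  rewrite subrK; move: h1; rewrite dotBl => /ler_normlP[h1 h1'].
  rewrite (dotC q p).
  have h4 : 0 < t * e by rewrite mulr_gt0.
  have h5 : t * (dot p q - dot p' q) <= t * (e / 4) by rewrite ler_wpM2l ?(ltW t0)//; lra.
  move: h5; rewrite mulrBr => h5.
  by move: h h2; lra.
have [z [g [[s /andP[s0 st] zs] zg cg]]] :=
  exists_frechet_ge L_gt0 uL t0 h3 (divr_gt0 e0 (ltr0n _ 4)).
exists z, g; split => //; last by rewrite (dotC q g).
rewrite (_ : z - y = (z - (x - t *: q + s *: q)) + ((s - t) *: q) + (x - y)); last first.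
  by apply/rowP => i; rewrite !mxE; ring.
have h6 : `|(s - t) *: q| <= e / 4.
  rewrite normrZ ltr0_norm ?subr_lt0// opprB (@le_trans _ _ (t * `|q|))//.
    by rewrite ler_wpM2r// lerBlDr lerDl ltW.
  by rewrite (le_trans tq)// /d' ge_min lexx orbT.
have h7 : `|x - y| <= e / 4 by rewrite (le_trans (ltW xy))// /e1 ge_min lexx orbT.
rewrite (le_lt_trans (ler_normD _ _))// (le_lt_trans (lerD (ler_normD _ _) h7))//.
by lra.
Qed.

(** Let q expose p. Near y there are points where u is differentiable with
    derivative along q almost dot q p. Their gradients are bounded and every limit
    lies in the sublevel of F y, on which only p has such a large value of dot q. *)
Lemma limit_superdiff_reachable y p : strictly_convex (F y) ->
  compact [set p | F y p <= - c y] -> continuous (F y) ->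
  limit_superdiff y p -> F y p + c y = 0 -> reachable_gradient u y p.
Proof.
move=> Fs Kc Fyc yp Fp.
have [q qP] := exposed_normal Fyc Fs Kc (p := p) ltac:(lra).
have /choice[z zP] : forall n : nat, exists z, exists g, 
    [/\ `|z - y| < n.+1%:R^-1, frechet u z g & dot q p - n.+1%:R^-1 <= dot q g].
  by move=> n; have [z [g h]] := @frechet_along y p q yp n.+1%:R^-1 ltac:(by rewrite invr_gt0); exists z, g.
have /choice[g gP] := zP.
have [G [GU Goo]] := @ultraFilterLemma nat \oo _.
have GP : ProperFilter G by exact: ultra_proper.
have eG : (n.+1%:R^-1 : R) @[n --> G] --> (0 : R) by exact: cvg_inv_natS.
have [P gG] : exists P : V, g @ G --> P.
  apply: (ultra_bounded_cvg GU (k := k + 1)) => n.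
  by have [_ /frechet_subsolution[_ ?] _] := gP n.
have zG : z @ G --> y.
  apply/cvgrPdist_lt => e e0; move/cvgrPdist_lt : eG => /(_ _ e0).
  apply: filterS => n; rewrite sub0r normrN => hn; rewrite distrC.
  by have [h _ _] := gP n; rewrite (lt_trans h)// (le_lt_trans (ler_norm _) hn).
have PE : P = p.
  apply: qP.
    suff : F y P + c y <= 0 by lra.
    by apply: (cvg_pair_le GP zG gG) => n; have [_ /frechet_subsolution[? _] _] := gP n.
  have h1 : dot q (g n) @[n --> G] --> dot q P by apply: cvg_dot => //; exact: cvg_cst.
  have h2 : dot q p - n.+1%:R^-1 @[n --> G] --> dot q p - 0 by apply: cvgB => //; exact: cvg_cst.
  rewrite -[leLHS]subr0; apply: (ler_cvg_to h2 h1); apply: nearW => n.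
  by have [_ _] := gP n.
rewrite PE in gG.
have h (n : nat) : exists x, [/\ differentiable u x, `|x - y| < n.+1%:R^-1 & `|grad u x - p| < n.+1%:R^-1].
  have n0 : 0 < n.+1%:R^-1 :> R by rewrite invr_gt0.
  have h1 : \forall i \near G, `|y - z i| < n.+1%:R^-1 by move/cvgrPdist_lt : zG => /(_ _ n0).
  have h2 : \forall i \near G, `|p - g i| < n.+1%:R^-1 by move/cvgrPdist_lt : gG => /(_ _ n0).
  have [i [zi gi]] := filter_ex (filterI h1 h2).
  have [_ /frechet_differentiable[du gE] _] := gP i.
  by exists (z i); split; rewrite // ?gE distrC.
have [x_ xP] := choice h; exists x_.
split.
- by move=> n; have [] := xP n.
- by apply: cvg_le_inv_natS => n; have [_ /ltW ? /ltW ?] := xP n.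
- by apply: cvg_le_inv_natS => n; have [_ /ltW ? /ltW ?] := xP n.
Qed.

End Reachable.

(** * Subsolutions at a point of the Aubry set *)

Section AubryPoint.
Context {R : realType} {N m : nat}.
Local Notation V := 'rV[R]_N.
Variables (H : 'I_m -> V -> V -> R) (B : V -> 'M[R]_m).
Hypotheses (H_ham : forall i, convex_hamiltonian (H i))
  (B_cont : forall i j, torus_continuous (fun x => B x i j))
  (B_degenerate : forall x, degenerate_mx (B x))
  (B_irreducible : forall x, irreducible_mx (B x)).
Implicit Types (u v : 'I_m -> V -> R).
Local Notation sub := (subsolution H B 0).

Lemma subsolution_lipschitz : exists2 L, 0 < L & forall u i, sub u -> lipV L (u i).
Proof.
have [k [C [k0 kC]]] := subsolution_equi H_ham B_cont B_degenerate B_irreducible.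
exists (N%:R * k + 1); first by rewrite ltr_wpDl// mulr_ge0.
move=> u i us; have [uk _] := kC u us; have [M M0 uM] := torus_bounded (us.1 i).
have uc : continuous (u i) := (us.1 i).1.
have h := superdiff_bound_lipschitz uc uM (fun z p => uk z i p).
by move=> x z; rewrite (le_trans (h x z))// ler_wpM2r// lerDl.
Qed.

(** The equi-Lipschitz and oscillation bounds make the supremum finite. *)
Lemma Phi_ge j y u i x : sub u -> u i x - u j y <= Phi H B i j y x.
Proof.
move=> us; have [L L0 LP] := subsolution_lipschitz.
have [k [C [k0 kC]]] := subsolution_equi H_ham B_cont B_degenerate B_irreducible.
apply: ub_le_sup; last by exists u.
exists (C + L * `|x - y|) => _ [v vs <-].
have h1 := (kC v vs).2 x i j.
have := LP v j vs x y => /ler_normlP[_ h2].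
by lra.
Qed.

Lemma Phi_diag j y u : sub u -> Phi H B j j y y = 0.
Proof.
move=> us; rewrite /Phi (_ : [set _ | _ in _] = [set 0]) ?sup1//.
apply/seteqP; split => [_ [v _ <-]|_ ->] /=; first by rewrite subrr.
by exists u => //; rewrite subrr.
Qed.

Variables (j0 : 'I_m) (y : V).
Hypothesis y_Aubry : Aubry H B j0 y.
Local Notation Ph := (fun i x => Phi H B i j0 y x).

Definition touches u j : Prop := forall x, u j x - Ph j x <= u j y - Ph j y.

(** Doubling of variables between the mean of the w a and the supersolution Phi,
    followed by passage to the limit at y in all the inequalities. *)
Lemma touching_gradients (I : finType) (s : seq I) (w : I -> 'I_m -> V -> R) j :
  (0 < size s)%N -> (forall a, sub (w a)) -> (forall a, touches (w a) j) ->
  exists P : I -> V, [/\ forall a, limit_superdiff (w a j) y (P a),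
    forall a, H j y (P a) + coupling B (w a) y j <= 0 &
    0 <= H j y (avgV s P) + coupling B Ph y j].
Proof.
move=> s0 ws wt.
have [k [C [k0 kC]]] := subsolution_equi H_ham B_cont B_degenerate B_irreducible.
have [Phs Php] := y_Aubry.
have Phc i : continuous (Ph i) := (Phs.1 i).1.
have wc a i : continuous (w a i) := ((ws a).1 i).1.
have [//||M M0 MP] := @finite_uniform_bound R (option I)
  (fun o M => forall x, `|if o is Some a then w a j x else Ph j x| <= M).
- by move=> o c c' cc' h x; rewrite (le_trans (h x)).
- move=> [a|]; first by have [M _ MP] := torus_bounded ((ws a).1 j); exists M.
  by have [M _ MP] := torus_bounded (Phs.1 j); exists M.
have [x [z [p [G [P [GP xy zy pP [zp xsub]]]]]]] :=
  doubling s0 (fun a => @wc a j) (fun a => MP (Some a))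
    (fun a z p => (kC (w a) (ws a)).1 z j p) (@Phc j) (MP None) wt.
have [Hc _ _ _] := H_ham j.
exists P; split.
- move=> a e e0.
  have h1 : \forall n \near G, `|y - z a n| < e by move/cvgrPdist_lt : (zy a) => /(_ _ e0).
  have h2 : \forall n \near G, `|P a - p a n| < e by move/cvgrPdist_lt : (pP a) => /(_ _ e0).
  have [n [zn pn]] := filter_ex (filterI h1 h2).
  by exists (z a n), (p a n); split; rewrite 1?distrC.
- move=> a; have cc : continuous (fun x => coupling B (w a) x j).
    by apply: coupling_continuous => // i; exact: wc.
  have h1 := cvg_joint GP Hc (zy a) (pP a).
  have h2 : coupling B (w a) (z a n) j @[n --> G] --> coupling B (w a) y j := cvg_comp _ _ (zy a) (@cc y).
  apply: (ler_cvg_to (cvgD h1 h2) (cvg_cst 0)); apply: nearW => n.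
  exact: (ws a).2 (zp a n).
- have cc : continuous (fun x => coupling B Ph x j) by exact: coupling_continuous.
  have h0 : avgV s (p ^~ n) - (x n - y) @[n --> G] --> avgV s P.
    have -> : avgV s P = avgV s P - (y - y) by rewrite subrr subr0.
    apply: cvgB.
      by apply: cvg_scale; apply: cvg_sum_seq.
    by apply: cvgB => //; exact: cvg_cst.
  have h1 := cvg_joint GP Hc xy h0.
  have h2 : coupling B Ph (x n) j @[n --> G] --> coupling B Ph y j := cvg_comp _ _ xy (@cc y).
  apply: (ler_cvg_to (cvg_cst 0) (cvgD h1 h2)); apply: nearW => n.
  exact: Php.2 (xsub n).
Qed.

(** The component j0 touches by definition of Phi. If j touches, comparing the
    subsolution and supersolution inequalities at y gives a nonnegative value of
    (B (Phi - u))_j, while Phi - u is minimal at j: by the signs of B, every k with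
    a nonzero entry B j k attains the minimum as well, hence touches.
    Irreducibility reaches all the components. *)
Lemma touches_all u : sub u ->
  (forall j, touches u j) /\ (forall j, coupling B u y j = coupling B Ph y j).
Proof.
move=> us.
pose d j := Ph j y - u j y.
have d0 : d j0 = - u j0 y by rewrite /d (Phi_diag j0 y us) sub0r.
have dge j : d j0 <= d j by rewrite d0 /d; have := Phi_ge j0 y j y us; lra.
have tch j : d j = d j0 -> touches u j.
  move=> dj x; have := Phi_ge j0 y j x us.
  by move: dj; rewrite d0 /d; lra.
have couplingB v j : coupling B v y j = \sum_k B y j k * (v k y - v j y).
  under [RHS]eq_bigr do rewrite mulrBr.
  by rewrite sumrB -mulr_suml (B_degenerate y).2 mul0r subr0.
(* The minimum of d propagates along the nonzero entries of B y. *)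
have eqd j k : d j = d j0 -> B y j k != 0 -> d k = d j0.
  move=> dj Bjk.
  have [P [_ h1 h2]] := @touching_gradients 'I_1 [:: ord0] (fun _ => u) j isT
    (fun=> us) (fun=> tch j dj).
  have avgE : avgV [:: ord0] P = P ord0 by rewrite /avgV /= big_seq1 invr1 scale1r.
  rewrite avgE in h2; have := h1 ord0 => {}h1.
  have : 0 <= coupling B Ph y j - coupling B u y j by lra.
  rewrite !couplingB -sumrB.
  have E l : B y j l * (Ph l y - Ph j y) - B y j l * (u l y - u j y) = B y j l * (d l - d j).
    by rewrite /d; ring.
  under eq_bigr do rewrite E.
  have npos l : B y j l * (d l - d j) <= 0.
    have [->|lj] := eqVneq l j; first by rewrite subrr mulr0.
    by rewrite mulr_le0_ge0// ?subr_ge0 ?dj// (B_degenerate y).1.1.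
  rewrite (bigD1 k)//= => h3.
  have h4 : \sum_(l | l != k) B y j l * (d l - d j) <= 0 by apply: sumr_le0.
  have : B y j k * (d k - d j) = 0 by have := npos k; lra.
  by move=> /eqP; rewrite mulf_eq0 (negbTE Bjk) subr_eq0 => /eqP ->.
pose I0 := [set j | d j == d j0]%SET.
have I0T : I0 = finset.setT.
  apply/eqP/negPn/negP => I0T.
  have [||j [k [jI kI Bjk]]] := B_irreducible y (I := I0).
  - by apply/finset.set0Pn; exists j0; rewrite inE.
  - by rewrite finset.properT.
  move: kI; rewrite inE => /negP; apply; apply/eqP; apply: (eqd j) => //.
  by move: jI; rewrite inE => /eqP.
have dE j : d j = d j0.
  have jI : j \in I0 by rewrite I0T inE.
  by move: jI; rewrite inE => /eqP.
split => [j|j]; first exact: tch.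
rewrite !couplingB; apply: eq_bigr => k _; congr (_ * _).
by have := dE j; have := dE k; rewrite /d; lra.
Qed.

(** The gradients given by touching_gradients lie in one sublevel of the strictly
    convex function H j y, and their mean lies on its boundary. *)
Lemma common_gradient (I : finType) (w : I -> 'I_m -> V -> R) j :
  (forall i x, strictly_convex (H i x)) -> (0 < #|I|)%N -> (forall a, sub (w a)) ->
  exists p, (forall a, limit_superdiff (w a j) y p) /\ H j y p = - coupling B Ph y j.
Proof.
move=> Hs I0 ws.
have sI : (0 < size (enum I))%N by rewrite -cardE.
have [P [h1 h2 h3]] := @touching_gradients I (enum I) w j sI ws
  (fun a => (touches_all (ws a)).1 j).
have h4 a : H j y (P a) <= - coupling B Ph y j.
  by have := h2 a; rewrite (touches_all (ws a)).2; lra.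
have h5 : - coupling B Ph y j <= H j y (avgV (enum I) P) by lra.
have PE a : P a = avgV (enum I) P.
  by apply: (strictly_convex_avg_eq (Hs j y) _ h5) => [b _|]; rewrite ?mem_enum.
exists (avgV (enum I) P); split; first by move=> a; rewrite -(PE a).
have /card_gt0P[a _] := I0.
by apply/le_anti; rewrite h5 -(PE a) h4.
Qed.

End AubryPoint.

(** * Common reachable gradients *)

Lemma continuous_slice (R : realType) (T U : topologicalType) (f : T * U -> R) (x : T) :
  continuous f -> continuous (fun z => f (x, z)).
Proof.
move=> fc z; have h : (x, z') @[z' --> z] --> (x, z) by apply: cvg_pair; [exact: cvg_cst|exact: cvg_id].
exact: (cvg_comp _ _ h (@fc (x, z))).
Qed.

Lemma limit_superdiff_closed (R : realType) (N : nat) (u : 'rV[R]_N -> R) y :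
  closed [set p | limit_superdiff u y p].
Proof.
move=> p cp e e0; have e20 : 0 < e / 2 by rewrite divr_gt0.
have [q [/= uq qp]] := cp _ (nbhsx_ballx p (e / 2) e20).
have [x [p' [xy p'q xp']]] := uq _ e20.
exists x, p'; split => //; first by rewrite (lt_trans xy)// ltr_pdivrMr// ltr_pMr// ltr1n.
move: qp; rewrite -ball_normE /= distrC => qp.
by rewrite (le_lt_trans (ler_distD q _ _))// (splitr e) ltrD.
Qed.

Theorem proposition4p4 (R : realType) (N m : nat)
    (H : 'I_m -> 'rV[R]_N -> 'rV[R]_N -> R) (B : 'rV[R]_N -> 'M[R]_m)
    (N_gt0 : (0 < N)%N) (m_gt0 : (0 < m)%N)
    (H_ham : forall i, convex_hamiltonian (H i))
    (B_cont : forall i j, torus_continuous (fun x => B x i j))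
    (B_degenerate : forall x, degenerate_mx (B x))
    (B_irreducible : forall x, irreducible_mx (B x))
    (c_eq0 : critical_value H B = 0%:E)
    (H_strict : forall i x, strictly_convex (H i x))
    (j0 : 'I_m) (y : 'rV[R]_N) (y_Aubry : Aubry H B j0 y) :
  forall i : 'I_m, exists p : 'rV[R]_N,
    (forall u, subsolution H B 0 u -> reachable_gradient (u i) y p) /\
    (forall u, subsolution H B 0 u -> H i y p + coupling B u y i = 0).
Proof.
move=> i.
pose Ph i x := Phi H B i j0 y x.
have Phsub : subsolution H B 0 Ph := y_Aubry.1.
have [k [C [k0 kC]]] := subsolution_equi H_ham B_cont B_degenerate B_irreducible.
have [L L0 LP] := subsolution_lipschitz H_ham B_cont B_degenerate B_irreducible.
have coup u : subsolution H B 0 u -> coupling B u y i = coupling B Ph y i.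
  by move=> us; exact: (touches_all H_ham B_cont B_degenerate B_irreducible y_Aubry us).2.
have Hc : continuous (fun z : 'rV[R]_N * 'rV[R]_N => H i z.1 z.2) by have [] := H_ham i.
have Hyc : continuous (H i y).
  exact: (continuous_slice (x := y) Hc).
have Kcompact (a : R) : compact [set p | H i y p <= a].
  have [l l0 lP] := H_coercive H_ham a.
  apply: (subclosed_compact _ (@ball_compact R N l)); last by move=> p; exact: lP.
  rewrite (_ : [set _ | _] = H i y @^-1` [set r | r <= a]) //.
  by apply: closed_comp; [move=> p _; exact: Hyc|exact: closed_le].
pose c := - coupling B Ph y i.
(* Classical choice structure on families of functions, as required to index the
   finite intersection property. *)
pose g (u : {classic 'I_m -> 'rV[R]_N -> R}) : set 'rV[R]_N :=
  [set p | limit_superdiff ((u : 'I_m -> 'rV[R]_N -> R) i) y p] `&` [set p | H i y p = c].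
pose A := [set p : 'rV[R]_N | `|p| <= k].
pose D : set {classic 'I_m -> 'rV[R]_N -> R} := [set u | subsolution H B 0 u].
have [p pP] : \bigcap_(u in D) (A `&` g u) !=set0.
  have := @ball_compact R N k; rewrite compact_In0; apply.
    exists g => // u us; apply: closedI; first exact: limit_superdiff_closed.
    rewrite (_ : [set _ | _] = H i y @^-1` [set r | r = c]) //.
    by apply: closed_comp; [move=> q _; exact: Hyc|exact: closed_eq].
  move=> D' D'D.
  have [D'0|D'0] := posnP #|{: D'}|.
    by exists 0 => u /= uD'; have /card0_eq/(_ [` uD']%fset) := D'0; rewrite inE.
  have ws (a : D') : subsolution H B 0 (val a) by exact: set_mem (D'D _ (valP a)).
  have [p [pl pH]] := common_gradient H_ham B_cont B_degenerate B_irreducible y_Aubry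
    i H_strict D'0 ws.
  exists p => u /= uD'; have := pl [` uD']%fset; rewrite /= => ul.
  split; last by split.
  rewrite /A /=; apply/ler_addgt0Pr => e e0.
  have [x [p' [_ pp' xp']]] := ul e e0.
  rewrite -(subrK p' p) addrC (le_trans (ler_normD _ _))// lerD//.
    by apply: (kC u _).1 xp'; exact: set_mem (D'D _ uD').
  by rewrite distrC ltW.
exists p; split => u us; have [_ [ul uH]] := pP u us.
  have [us1 us2] := us.
  apply: (@limit_superdiff_reachable R N (u i) (fun x => coupling B u x i) (H i) L k) => //.
  - exact: LP.
  - by apply: coupling_continuous => // j; exact: (us1 j).1.
  - by move=> x q; exact: (kC u us).1.
  - by move=> x q; exact: us2.
  - by rewrite uH /c -(coup u us) addNr.
by rewrite uH /c -(coup u us) addNr.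
Qed.
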